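(* Let $M$ be a smooth manifold and $\nabla$ a higher connection on $M$. For $\omega\in\Omega^l(M)$, $X\in A^k(M)$ with $k>0$, and $f\in C^\infty(M)$: (i) $\nabla_{fX}\omega=f\nabla_X\omega$; (ii) $\nabla_X(f\omega)=f\nabla_X\omega+i_{[X,f]}\omega$. If $\nabla$ is also upper induced, then (iii) $\nabla_X(i_W\omega)=(-1)^{j(k-1)}\left(i_W\nabla_X\omega+i_{\nabla_XW}\omega\right)$ for $W\in A^j(M)$.
   Context: $A^k(M):=\Gamma(\wedge^kTM)$ for $k\ge0$ ($A^0(M)=C^\infty(M)$), $A^k(M):=0$ and $\Omega^k(M):=0$ for $k<0$, $\mathcal{A}(M):=\bigoplus_kA^k(M)$. Schouten–Nijenhuis bracket: the unique $\mathbb{R}$-bilinear map $[\cdot,\cdot]:A^k(M)\times A^l(M)\to A^{k+l-1}(M)$ such that $[f,g]=0$ for functions; $[X,Q]=L_XQ$ for $X\in A^1(M)$; $[P,Q]=-(-1)^{(p-1)(q-1)}[Q,P]$ and $[P,Q\wedge R]=[P,Q]\wedge R+(-1)^{(p-1)q}Q\wedge[P,R]$ for $P\in A^p(M)$, $Q\in A^q(M)$, $R\in\mathcal{A}(M)$. A higher (affine) connection on $M$ is a map $\nabla:\mathcal{A}(M)\times\mathcal{A}(M)\to\mathcal{A}(M)$, $(X,Y)\mapsto\nabla_XY$, such that (i) $\nabla_XY\in A^{k+l-1}(M)$ for $X\in A^k(M)$, $Y\in A^l(M)$; (ii) $\nabla_{fX+X'}Y=f\nabla_XY+\nabla_{X'}Y$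 for $f\in C^\infty(M)$; (iii) $\nabla_X(Y+Y')=\nabla_XY+\nabla_XY'$; (iv) $\nabla_Xf=[X,f]$ for $f\in C^\infty(M)$; (v) $\nabla_X(fY)=[X,f]\wedge Y+f\nabla_XY$ for $f\in C^\infty(M)$; (vi) $\nabla_fX=0$ for $f\in C^\infty(M)$. It is upper induced if $\nabla_X(Y\wedge Z)=(\nabla_XY)\wedge Z+(-1)^{(k-1)l}Y\wedge\nabla_XZ$ for $X\in A^k(M)$, $Y\in A^l(M)$, $Z\in\mathcal{A}(M)$. Forms: $\omega\in\Omega^k(M)$ is evaluated on $k$-vectors by $(\omega^1\wedge\cdots\wedge\omega^k)(v_1\wedge\cdots\wedge v_k)=\det(\omega^i(v_j))$; for $\omega\in\Omega^0(M)$ and $f\in A^0(M)$, $\omega(f):=f\omega$. For $X\in A^k(M)$, $k\ge1$, $i_X:\Omega^l(M)\to\Omega^{l-k}(M)$ is $(i_X\omega)(Y)=\omega(X\wedge Y)$ for $l>k$, $i_X\omega=\omega(X)$ for $l=k$, $i_X\omega=0$ for $l<k$; $i_f\omega:=f\omega$ for functions. $L_X\omega:=d\,i_X\omega-(-1)^ki_Xd\omega$ for $X\in A^k(M)$, $k\ge1$. For $\omega\in\Omega^l(M)$, $X\in A^k(M)$, $k>0$, $l-k+1\ge0$, the form $\nabla_X\omega\in\Omega^{l-k+1}(M)$ is defined by $(\nabla_X\omega)(Y):=(-1)^{(k-1)(l-1)}L_Xi_Y\omega-\omega(\nabla_XY)$ for $Y\in A^{l-k+1}(M)$; for $k=0$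 or $l-k+1<0$, $\nabla_X\omega:=0$. *)

(* Defs.v *)
From mathcomp Require Import all_boot all_order all_algebra.
From mathcomp Require Import all_classical all_reals all_analysis.
Import Order.TTheory GRing.Theory Num.Theory.
Import numFieldNormedType.Exports.

Set Implicit Arguments.
Unset Strict Implicit.
Unset Printing Implicit Defensive.

Local Open Scope ring_scope.

(* The exterior algebra of [R^n], in coordinates on the basis
   [e_S = e_{i_1} /\ ... /\ e_{i_k}], [S = {i_1 < ... < i_k}].  The same model
   is used for the dual space, with the basis of the [e^S]. *)
Definition ext (R : realType) (n : nat) := {ffun {set 'I_n} -> R^o}.

Definition ext_e {R : realType} {n : nat} (S : {set 'I_n}) : ext R n :=
  [ffun T => (T == S)%:R].

Definition ext_b {R : realType} {n : nat} (i : 'I_n) : ext R n :=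
  ext_e (finset.set1 i).

Definition ext_vec {R : realType} {n : nat} (v : 'rV[R]_n) : ext R n :=
  \sum_i v 0 i *: ext_b i.

(* The sign of the permutation sorting [S] followed by [T]. *)
Definition shuffle_sign (R : realType) n (S T : {set 'I_n}) : R :=
  (-1) ^+ #|[pred ij : 'I_n * 'I_n |
              [&& ij.1 \in S, ij.2 \in T & (ij.2 < ij.1)%N]]|.

Definition wedge {R : realType} {n : nat} (x y : ext R n) : ext R n :=
  [ffun S : {set 'I_n} => \sum_(T : {set 'I_n} | T \subset S)
    shuffle_sign R T (S :\: T) * x T * y (S :\: T)].

(* As [e^S(e_T) = det (e^{s_i}(e_{t_j}))] is [1] if [S = T] and [0] otherwise,
   this is the evaluation of forms on multivectors for the determinant
   convention. *)
Definition ext_pair {R : realType} {n : nat} (w x : ext R n) : R :=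
  \sum_(S : {set 'I_n}) w S * x S.

(* Interior product: [ext_pair (contract x w) y = ext_pair w (wedge x y)]; it
   vanishes when the degree of [x] exceeds that of [w]. *)
Definition contract {R : realType} {n : nat} (x w : ext R n) : ext R n :=
  [ffun S => ext_pair w (wedge x (ext_e S))].

Definition homog {R : realType} {n : nat} (k : int) (x : ext R n) : Prop :=
  forall S : {set 'I_n}, #|S|%:Z != k -> x S = 0.

(* The map induced on exterior algebras by [v |-> v *m J]. *)
Definition ext_push {R : realType} {n : nat} (J : 'M[R]_n) (x : ext R n)
    : ext R n :=
  \sum_(S : {set 'I_n})
    x S *: \big[@wedge R n/ext_e finset.set0]_(i <- enum S) ext_vec (row i J).

Definition ext_pull {R : realType} {n : nat} (J : 'M[R]_n) (w : ext R n)
    : ext R n :=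
  [ffun S => ext_pair w (ext_push J (ext_e S))].

Definition iter_partial {R : realType} {n : nat} (s : seq 'I_n)
    (f : 'rV[R]_n -> R) : 'rV[R]_n -> R :=
  foldr (fun i g => fun x => 'D_(delta_mx 0 i) g x) f s.

(* All iterated partial derivatives exist and are differentiable on [U]. *)
Definition smooth_on {R : realType} {n : nat} (U : set 'rV[R]_n)
    (f : 'rV[R]_n -> R) : Prop :=
  forall (s : seq 'I_n) (x : 'rV[R]_n), U x ->
    differentiable (iter_partial s f : 'rV[R]_n -> R^o) x.

Definition ext_partial {R : realType} {n : nat} (i : 'I_n)
    (F : 'rV[R]_n -> ext R n) (x : 'rV[R]_n) : ext R n :=
  [ffun S => 'D_(delta_mx 0 i) (fun y => F y S) x].

Local Open Scope classical_set_scope.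

(* A manifold comes with a (not necessarily maximal) smooth atlas and, as
   part of the data, a chart around each of its points. *)
Record manifold (R : realType) (n : nat) := Manifold {
  carrier :> topologicalType;
  chart : Type;
  dom : chart -> set carrier;
  coord : chart -> carrier -> 'rV[R]_n;
  param : chart -> 'rV[R]_n -> carrier;
  chart_at : carrier -> chart;
  manifold_hausdorff : hausdorff_space carrier;
  manifold_second_countable : @second_countable carrier;
  dom_open : forall a, open (dom a);
  coord_open : forall a, open (coord a @` dom a);
  coordK : forall a p, dom a p -> param a (coord a p) = p;
  coord_continuous : forall a p, dom a p -> {for p, continuous (coord a)};
  param_continuous : forall a x, (coord a @` dom a) x ->
    {for x, continuous (param a)};
  chart_atP : forall p, dom (chart_at p) p;
  transition_smooth : forall a b (j : 'I_n),
    smooth_on (coord a @` (dom a `&` dom b))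
      (fun x => coord b (param a x) 0 j)
}.

Definition smooth_fun {R : realType} {n : nat} {M : manifold R n} (f : M -> R)
    : Prop :=
  forall a : chart M, smooth_on (coord a @` dom a) (f \o param a).

(* The tangent space at [p] is [R^n] by means of the chart [chart_at p], so
   that a section of the exterior algebra bundle of [TM] or of [T^*M] is a map
   to [ext R n].  By [transition a b p], a vector with components [v] in the
   chart [a] has components [v *m transition a b p] in the chart [b]. *)
Definition section {R : realType} {n : nat} (M : manifold R n) := M -> ext R n.

Definition transition {R : realType} {n : nat} {M : manifold R n}
    (a b : chart M) (p : M) : 'M[R]_n :=
  'J (fun x => coord b (param a x)) (coord a p).

Definition mv_in_chart {R : realType} {n : nat} {M : manifold R n}
    (a : chart M) (X : section M) (x : 'rV[R]_n) : ext R n :=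
  let p := param a x in ext_push (transition (chart_at p) a p) (X p).

Definition form_in_chart {R : realType} {n : nat} {M : manifold R n}
    (a : chart M) (w : section M) (x : 'rV[R]_n) : ext R n :=
  let p := param a x in ext_pull (transition a (chart_at p) p) (w p).

Definition multivector {R : realType} {n : nat} {M : manifold R n}
    (X : section M) : Prop :=
  forall (a : chart M) (S : {set 'I_n}),
    smooth_on (coord a @` dom a) (fun x => mv_in_chart a X x S).

Definition kvector {R : realType} {n : nat} {M : manifold R n} (k : int)
    (X : section M) : Prop :=
  multivector X /\ forall p, homog k (X p).

Definition kform {R : realType} {n : nat} {M : manifold R n} (k : int)
    (w : section M) : Prop :=
  (forall (a : chart M) (S : {set 'I_n}),
    smooth_on (coord a @` dom a) (fun x => form_in_chart a w x S))
  /\ forall p, homog k (w p).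

Definition fsec {R : realType} {n : nat} {M : manifold R n} (f : M -> R)
    : section M := fun p => f p *: ext_e finset.set0.

Definition fscale {R : realType} {n : nat} {M : manifold R n} (f : M -> R)
    (X : section M) : section M := fun p => f p *: X p.

Definition swedge {R : realType} {n : nat} {M : manifold R n}
    (X Y : section M) : section M := fun p => wedge (X p) (Y p).

Definition form_eval {R : realType} {n : nat} {M : manifold R n}
    (w X : section M) : M -> R := fun p => ext_pair (w p) (X p).

Definition iprod {R : realType} {n : nat} {M : manifold R n}
    (X w : section M) : section M := fun p => contract (X p) (w p).

Definition ext_d {R : realType} {n : nat} {M : manifold R n} (w : section M)
    : section M :=
  fun p => let a := chart_at p in
    \sum_i wedge (ext_b i)
      (ext_partial i (form_in_chart a w) (coord a p)).

(* [k >= 1] is the degree of [X]. *)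
Definition lie_form {R : realType} {n : nat} {M : manifold R n} (k : int)
    (X w : section M) : section M :=
  ext_d (iprod X w) - ((-1) ^ k : R) *: iprod X (ext_d w).

(* [L_X Q] for a vector field [X] and a multivector field [Q]: in a chart,
   [L_X] is the derivation of the exterior algebra given by
   [L_X f = \sum_i X^i d_i f] on functions and by
   [L_X d_i = [X, d_i] = - \sum_j (d_i X^j) d_j] on coordinate fields. *)
Definition lie_mv {R : realType} {n : nat} {M : manifold R n}
    (X Q : section M) : section M :=
  fun p => let a := chart_at p in
    \sum_i (X p (finset.set1 i) *: ext_partial i (mv_in_chart a Q) (coord a p)
            - wedge (ext_partial i (mv_in_chart a X) (coord a p))
                    (contract (ext_b i) (Q p))).

(* An operation on multivector fields is represented by a map on all sections;
   its values elsewhere play no role.  The conditions on [br] determine it on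
   multivector fields. *)
Record schouten_bracket {R : realType} {n : nat} {M : manifold R n}
    (br : section M -> section M -> section M) : Prop := {
  br_linearl : forall (c : R) X X' Y,
    multivector X -> multivector X' -> multivector Y ->
    br (c *: X + X') Y = c *: br X Y + br X' Y;
  br_linearr : forall (c : R) X Y Y',
    multivector X -> multivector Y -> multivector Y' ->
    br X (c *: Y + Y') = c *: br X Y + br X Y';
  br_degree : forall (k l : int) X Y,
    kvector k X -> kvector l Y -> kvector (k + l - 1) (br X Y);
  br_fun : forall f g : M -> R, smooth_fun f -> smooth_fun g ->
    br (fsec f) (fsec g) = 0;
  br_lie : forall X Q, kvector 1 X -> multivector Q -> br X Q = lie_mv X Q;
  br_antisym : forall (p q : int) P Q, kvector p P -> kvector q Q ->
    br P Q = - (((-1) ^ ((p - 1) * (q - 1)) : R) *: br Q P);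
  br_leibniz : forall (p q : int) P Q Z,
    kvector p P -> kvector q Q -> multivector Z ->
    br P (swedge Q Z) = swedge (br P Q) Z
      + ((-1) ^ ((p - 1) * q) : R) *: swedge Q (br P Z)
}.

Record higher_connection {R : realType} {n : nat} {M : manifold R n}
    (br nabla : section M -> section M -> section M) : Prop := {
  nabla_multivector : forall X Y, multivector X -> multivector Y ->
    multivector (nabla X Y);
  nabla_degree : forall (k l : int) X Y,
    kvector k X -> kvector l Y -> kvector (k + l - 1) (nabla X Y);
  nabla_linearl : forall f X X' Y, smooth_fun f ->
    multivector X -> multivector X' -> multivector Y ->
    nabla (fscale f X + X') Y = fscale f (nabla X Y) + nabla X' Y;
  nabla_addr : forall X Y Y',
    multivector X -> multivector Y -> multivector Y' ->
    nabla X (Y + Y') = nabla X Y + nabla X Y';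
  nabla_fun : forall X f, multivector X -> smooth_fun f ->
    nabla X (fsec f) = br X (fsec f);
  nabla_leibniz : forall f X Y, smooth_fun f ->
    multivector X -> multivector Y ->
    nabla X (fscale f Y) = swedge (br X (fsec f)) Y + fscale f (nabla X Y);
  nabla_funl : forall f X, smooth_fun f -> multivector X ->
    nabla (fsec f) X = 0
}.

Definition upper_induced {R : realType} {n : nat} {M : manifold R n}
    (nabla : section M -> section M -> section M) : Prop :=
  forall (k l : int) X Y Z,
    kvector k X -> kvector l Y -> multivector Z ->
    nabla X (swedge Y Z) = swedge (nabla X Y) Z
      + ((-1) ^ ((k - 1) * l) : R) *: swedge Y (nabla X Z).

(* [is_nabla_form nabla k X l w h]: the form [h] of degree [l - k + 1]
   satisfies the equation defining [nabla_X w], for [X] of degree [k] and [w]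
   of degree [l].  Both sides of the equation are forms of degree [0]. *)
Definition is_nabla_form {R : realType} {n : nat} {M : manifold R n}
    (nabla : section M -> section M -> section M)
    (k : int) (X : section M) (l : int) (w h : section M) : Prop :=
  kform (l - k + 1) h /\
  forall Y, kvector (l - k + 1) Y ->
    fsec (form_eval h Y) =
      ((-1) ^ ((k - 1) * (l - 1)) : R) *: lie_form k X (iprod Y w)
      - fsec (form_eval w (nabla X Y)).

(* A form is determined by its values on multivector fields;
   that the form exists is the tensoriality in [Y] of the equation above. *)
Definition nabla_form {R : realType} {n : nat} {M : manifold R n}
    (nabla : section M -> section M -> section M)
    (k : int) (X : section M) (l : int) (w : section M) : section M :=
  if (0 < k) && (0 <= l - k + 1)
  then xget 0 [set h | is_nabla_form nabla k X l w h] else 0.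

(* Main.v *)
(** The right-hand side of the equation defining [nabla_X w] is linear in [Y]
    over the functions: the two derivation terms cancel because of
    [[X, f] = (-1)^(k-1) i_df X], which itself follows from the axioms of the
    bracket, [[f, -]] being linear over the functions and an antiderivation.
    By means of bump functions such an expression only depends on the value of
    [Y] at a point, so that it is the evaluation of a form.  This form is
    smooth: by Cartan's formula [<dw, X /\ Q>] is expressed with
    brackets [[X, Q]] and with the differential of [i_X w], and brackets are
    smooth by assumption.  The three identities then follow by comparing the
    defining equations, as a form is determined by its values. *)

(* The main obstacle is that [ext_d] and [lie_mv] are computed at each point [p] in the chart
   [chart_at p], which is chosen without any continuity in [p]. Identities at a single point are
   then easy, but the smoothness of [ext_d w] cannot be read off its definition: a direct proof
   would need the naturality of [d] under changes of charts, hence the symmetry of second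
   derivatives. Cartan's formula, which is proved at one point in one chart, avoids this, because
   all its other terms are known to be smooth or come under an induction on the degree.

   A second constraint is that the axioms on [br] and [nabla] speak of global fields only and
   contain no locality statement. Coordinate fields therefore enter as [frame a f S], cut off by a
   bump function [f]. The price is a surplus factor [f] in the multiplication rules, removed by
   division where [f] is positive.

   Forms and multivectors share one self-dual model, in which [ext_pair] is symmetric. Hence each
   rule for [contract] serves both for a vector acting on forms and for a covector acting on
   multivectors. *)
From mathcomp Require Import all_boot all_order all_algebra.
From mathcomp Require Import reals.
From mathcomp Require Import ring lra zify.
Require Import Defs.
Import Order.TTheory GRing.Theory Num.Theory.
Set Implicit Arguments.
Unset Strict Implicit.
Unset Printing Implicit Defensive.
Local Open Scope ring_scope.

(** * The exterior algebra *)

Notation ext_1 := (ext_e set0).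

Section ExteriorAlgebra.
Context {R : realType} {n : nat}.
Implicit Types (x y z w : ext R n) (S T U : {set 'I_n}) (c : R).

Lemma signzD (k l : int) : (-1 : R) ^ (k + l) = (-1) ^ k * (-1) ^ l.
Proof. by rewrite expfzDr // oppr_eq0 oner_eq0. Qed.

(** Signs are compared by giving half the difference of the exponents as an explicit polynomial [m];
    what remains is a goal for [ring]. *)
Lemma signz_eq_mod2 (k l m : int) : k = l + 2 * m -> (-1 : R) ^ k = (-1) ^ l.
Proof.
by move=> ->; rewrite signzD -exprz_exp -exprnP sqrrN expr1n exp1rz mulr1.
Qed.

Lemma signz_pm (k : int) : (-1 : R) ^ k = 1 \/ (-1 : R) ^ k = -1.
Proof.
have sq : ((-1 : R) ^ k) ^+ 2 = 1.
  by rewrite exprnP exprz_exp mulrC -exprz_exp -exprnP sqrrN expr1n exp1rz.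
by move/eqP: sq; rewrite sqrf_eq1 => /orP[] /eqP; [left|right].
Qed.

(** Here half of [k * k - k] is not a polynomial with integer coefficients, so [signz_eq_mod2] with
    [ring] does not apply; the two possible values of the sign are inspected instead. *)
Lemma signz_sq (k : int) : (-1 : R) ^ (k * k) = (-1) ^ k.
Proof. by rewrite -exprz_exp; case: (signz_pm k) => E; rewrite E ?exp1rz ?E. Qed.

Lemma ext_sum x : x = \sum_(S : {set 'I_n}) x S *: ext_e S.
Proof.
apply/ffunP => T; rewrite sum_ffunE (bigD1 T) //= big1 => [|S ST].
  by rewrite !ffunE eqxx addr0 [RHS]mulr1.
by rewrite !ffunE eq_sym (negPf ST); exact: mulr0.
Qed.

Lemma wedgeDl x y z : wedge (x + y) z = wedge x z + wedge y z.
Proof.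
apply/ffunP => S; rewrite !ffunE -big_split /=; apply: eq_bigr => T _.
by rewrite ffunE; ring.
Qed.

Lemma wedgeDr x y z : wedge x (y + z) = wedge x y + wedge x z.
Proof.
apply/ffunP => S; rewrite !ffunE -big_split /=; apply: eq_bigr => T _.
by rewrite ffunE; ring.
Qed.

Lemma wedgeZl c x y : wedge (c *: x) y = c *: wedge x y.
Proof.
apply/ffunP => S; rewrite !ffunE scaler_sumr; apply: eq_bigr => T _.
by rewrite ffunE /GRing.scale /=; ring.
Qed.

Lemma wedgeZr c x y : wedge x (c *: y) = c *: wedge x y.
Proof.
apply/ffunP => S; rewrite !ffunE scaler_sumr; apply: eq_bigr => T _.
by rewrite ffunE /GRing.scale /=; ring.
Qed.

Lemma wedge0l x : wedge 0 x = 0.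
Proof. by apply: (addrI (wedge 0 x)); rewrite -wedgeDl !addr0. Qed.

Lemma wedge0r x : wedge x 0 = 0.
Proof. by apply: (addrI (wedge x 0)); rewrite -wedgeDr !addr0. Qed.

Lemma wedgeNl x y : wedge (- x) y = - wedge x y.
Proof. by rewrite -scaleN1r wedgeZl scaleN1r. Qed.

Lemma wedgeNr x y : wedge x (- y) = - wedge x y.
Proof. by rewrite -scaleN1r wedgeZr scaleN1r. Qed.

Lemma wedge_suml (I : Type) (r : seq I) (P : pred I) (F : I -> ext R n) y :
  wedge (\sum_(i <- r | P i) F i) y = \sum_(i <- r | P i) wedge (F i) y.
Proof.
exact: (big_morph (fun x => wedge x y) (fun a b => wedgeDl a b y) (wedge0l y)).
Qed.

Lemma wedge_sumr (I : Type) (r : seq I) (P : pred I) (F : I -> ext R n) x :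
  wedge x (\sum_(i <- r | P i) F i) = \sum_(i <- r | P i) wedge x (F i).
Proof. exact: (big_morph (wedge x) (wedgeDr x) (wedge0r x)). Qed.

(** The multiplication table behind all later identities. At [U] only the index [S] of the sum
    contributes, and for [S \subset U] the condition [U :\: S = T] means that [S] and [T] are
    disjoint with union [U]. *)
Lemma wedge_ee S T :
  wedge (ext_e S) (ext_e T) =
    ([disjoint S & T]%:R * shuffle_sign R S T) *: ext_e (S :|: T) :> ext R n.
Proof.
apply/ffunP => U; rewrite !ffunE.
have [SU|SU] := boolP (S \subset U); last first.
  rewrite big1 => [|V VU]; last first.
    rewrite !ffunE; case: eqP => [VS|_]; last by rewrite mulr0 mul0r.
    by rewrite -VS VU in SU.
  case: eqP => [UE|_]; last by rewrite scaler0.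
  by rewrite UE subsetUl in SU.
rewrite (bigD1 S) //= big1 => [|V /andP[VU VS]]; last first.
  by rewrite !ffunE (negPf VS) mulr0 mul0r.
rewrite !ffunE eqxx mulr1 addr0 /GRing.scale /=.
have [UT|UT] := eqVneq (U :\: S) T.
  have -> : [disjoint S & T].
    by rewrite -UT disjoint_sym disjoints_subset; apply/subsetP => i; rewrite !inE => /andP[].
  rewrite UT; have -> : U = S :|: T.
    by rewrite -UT setUC -{1}(setID U S) (setIidPr SU) setUC.
  by rewrite eqxx mul1r mulr1.
rewrite mulr0.
have [UE|_] := eqVneq U (S :|: T); last by rewrite mulr0.
have [dST|_] := boolP [disjoint S & T]; last by rewrite !mul0r.
case/eqP: UT; rewrite UE; apply/setP => i; rewrite !inE.
have [iS|//] := boolP (i \in S).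
by rewrite (disjointFr dST iS).
Qed.

Lemma ext_ind (P : ext R n -> Prop) :
  P 0 -> (forall x y, P x -> P y -> P (x + y)) ->
  (forall c x, P x -> P (c *: x)) -> (forall S, P (ext_e S)) -> forall x, P x.
Proof.
move=> P0 PD PZ Pe x; rewrite (ext_sum x).
by elim/big_rec: _ => // S y _; apply: PD; exact: PZ.
Qed.

Lemma shuffle_signUl S T U : [disjoint S & T] ->
  shuffle_sign R (S :|: T) U = shuffle_sign R S U * shuffle_sign R T U.
Proof.
move=> dST; rewrite /shuffle_sign -exprD -cardUI [X in (_ + X)%N]eq_card0.
  by rewrite addn0; congr (_ ^+ _); apply: eq_card => -[i j]; rewrite !inE /= andb_orl.
move=> [i j]; rewrite !inE /=; apply/negP => /andP[/andP[iS _] /andP[iT _]].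
by rewrite (disjointFr dST iS) in iT.
Qed.

Lemma shuffle_signUr S T U : [disjoint T & U] ->
  shuffle_sign R S (T :|: U) = shuffle_sign R S T * shuffle_sign R S U.
Proof.
move=> dTU; rewrite /shuffle_sign -exprD -cardUI [X in (_ + X)%N]eq_card0.
  rewrite addn0; congr (_ ^+ _); apply: eq_card => -[i j]; rewrite !inE /=.
  by rewrite andb_orl andb_orr.
move=> [i j]; rewrite !inE /=; apply/negP => /andP[/and3P[_ iS _] /and3P[_ iT _]].
by rewrite (disjointFr dTU iS) in iT.
Qed.

Lemma shuffle_sign_sq S T : shuffle_sign R S T * shuffle_sign R S T = 1.
Proof. by rewrite /shuffle_sign -expr2 sqrr_sign. Qed.

(** On basis elements both signs are the product of the inversion counts of the three pairs
    [(S, T)], [(S, U)] and [(T, U)], and both sides vanish unless the three sets are pairwise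
    disjoint. *)
Lemma wedgeA x y z : wedge x (wedge y z) = wedge (wedge x y) z.
Proof.
elim/ext_ind: x => [|x x' Hx Hx'|c x Hx|S].
- by rewrite !wedge0l.
- by rewrite !wedgeDl Hx Hx'.
- by rewrite !wedgeZl Hx.
elim/ext_ind: y => [|y y' Hy Hy'|c y Hy|T].
- by rewrite !(wedge0l, wedge0r).
- by rewrite !(wedgeDl, wedgeDr) Hy Hy'.
- by rewrite !(wedgeZl, wedgeZr) Hy.
elim/ext_ind: z => [|z z' Hz Hz'|c z Hz|U].
- by rewrite !wedge0r.
- by rewrite !wedgeDr Hz Hz'.
- by rewrite !wedgeZr Hz.
rewrite !wedge_ee wedgeZl wedgeZr !wedge_ee !scalerA setUA; congr (_ *: _).
have dUr : [disjoint S & T :|: U] = [disjoint S & T] && [disjoint S & U].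
  by rewrite -!setI_eq0 setIUr setU_eq0.
have dUl : [disjoint S :|: T & U] = [disjoint S & U] && [disjoint T & U].
  by rewrite -!setI_eq0 setIUl setU_eq0.
rewrite dUl dUr.
have [dST|_] := boolP [disjoint S & T]; last by rewrite /=; ring.
have [dTU|_] := boolP [disjoint T & U]; last by rewrite ?andbF /=; ring.
by rewrite shuffle_signUl // shuffle_signUr // andbT /=; ring.
Qed.

Lemma wedge1x x : wedge ext_1 x = x.
Proof.
elim/ext_ind: x => [|x y Hx Hy|c x Hx|S].
- by rewrite wedge0r.
- by rewrite wedgeDr Hx Hy.
- by rewrite wedgeZr Hx.
rewrite wedge_ee set0U -setI_eq0 set0I eqxx mul1r /shuffle_sign eq_card0 ?scale1r //.
by move=> ij; rewrite !inE.
Qed.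

Lemma wedgex1 x : wedge x ext_1 = x.
Proof.
elim/ext_ind: x => [|x y Hx Hy|c x Hx|S].
- by rewrite wedge0l.
- by rewrite wedgeDl Hx Hy.
- by rewrite wedgeZl Hx.
rewrite wedge_ee setU0 -setI_eq0 setI0 eqxx mul1r /shuffle_sign eq_card0 ?scale1r //.
by move=> ij; rewrite !inE andbF.
Qed.

Lemma homog0 (k : int) : homog k (0 : ext R n).
Proof. by move=> S _; rewrite ffunE. Qed.

Lemma homogD (k : int) x y : homog k x -> homog k y -> homog k (x + y).
Proof. by move=> hx hy S Sk; rewrite ffunE hx // hy // addr0. Qed.

Lemma homogZ (k : int) c x : homog k x -> homog k (c *: x).
Proof. by move=> hx S Sk; rewrite ffunE hx // scaler0. Qed.

Lemma homog_sum (k : int) (I : Type) (r : seq I) (P : pred I)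
    (F : I -> ext R n) :
  (forall i, P i -> homog k (F i)) -> homog k (\sum_(i <- r | P i) F i).
Proof.
by move=> hF; elim/big_ind: _ => //; [exact: homog0|move=> x y; exact: homogD].
Qed.

Lemma homog_e S : homog #|S|%:Z (ext_e S : ext R n).
Proof. by move=> T; rewrite ffunE; have [->|//] := eqVneq T S; rewrite eqxx. Qed.

Lemma homog_b (i : 'I_n) : homog 1 (ext_b i : ext R n).
Proof. by rewrite -[1]/(1%:Z) -(cards1 i); exact: homog_e. Qed.

Lemma homog_1 : homog 0 (ext_1 : ext R n).
Proof. by rewrite -[0]/(0%:Z) -(cards0 'I_n); exact: homog_e. Qed.

Lemma homog_wedge (k l : int) x y :
  homog k x -> homog l y -> homog (k + l) (wedge x y).
Proof.
move=> hx hy S Sk; rewrite ffunE big1 // => T TS.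
have [Tk|Tk] := eqVneq #|T|%:Z k; last by rewrite hx // mulr0 mul0r.
rewrite hy ?mulr0 //; apply: contra Sk => /eqP STl.
rewrite -Tk -STl; apply/eqP; rewrite -PoszD; congr Posz.
by rewrite cardsD (setIidPr TS) subnKC // subset_leq_card.
Qed.

Lemma homog_eq0 (k : int) x : k < 0 -> homog k x -> x = 0.
Proof.
move=> k0 hx; apply/ffunP => S; rewrite hx ?ffunE //.
by rewrite gt_eqF // (lt_le_trans k0).
Qed.

Lemma homog0E x : homog 0 x -> x = x set0 *: ext_1.
Proof.
move=> hx; apply/ffunP => S; rewrite !ffunE.
have [->|S0] := eqVneq S set0; first by rewrite [RHS]mulr1.
have -> : x S = 0 by apply: hx; rewrite (eqz_nat _ 0) cards_eq0.
by rewrite scaler0.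
Qed.

Lemma homog1E x : homog 1 x -> x = \sum_i x [set i] *: ext_b i.
Proof.
move=> hx; apply/ffunP => S; rewrite sum_ffunE.
have [/eqP/cards1P[i ->]|S1] := eqVneq #|S| 1%N.
  rewrite (bigD1 i) //= big1 => [|j ji]; rewrite !ffunE ?eqxx ?addr0 ?[RHS]mulr1 //.
  by rewrite (inj_eq set1_inj) eq_sym (negPf ji); exact: mulr0.
rewrite hx; last by rewrite (eqz_nat _ 1).
rewrite big1 // => i _; rewrite !ffunE; case: eqP => [SE|_]; last exact: mulr0.
by rewrite SE cards1 in S1.
Qed.

(** * Induction on the least index, and graded commutativity *)

(** Both lists are strictly increasing with the same elements. This connects the product over
    [enum S] in [ext_push] with exterior multiplication by one basis vector. *)
Lemma enum_setU1_min (m : 'I_n) S : (forall j, j \in S -> (m < j)%N) ->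
  enum (m |: S) = m :: enum S.
Proof.
move=> mS; set r := relpre (@nat_of_ord n) ltn.
have rtr : transitive r by move=> a b c; exact: ltn_trans.
have rirr : irreflexive r by move=> a; exact: ltnn.
have senum (T : {set 'I_n}) : sorted r (enum T).
  rewrite {1}/enum_mem; apply: sorted_filter => //.
  by rewrite -sorted_map -enumT val_enum_ord iota_ltn_sorted.
apply: (irr_sorted_eq rtr rirr); first exact: senum.
  rewrite /= path_sortedE // senum andbT.
  by apply/allP => j; rewrite mem_enum; exact: mS.
by move=> j; rewrite inE !mem_enum !inE.
Qed.

Lemma ext_e_setU1_min (m : 'I_n) S : (forall j, j \in S -> (m < j)%N) ->
  ext_e (m |: S) = wedge (ext_b m) (ext_e S) :> ext R n.
Proof.
move=> mS; rewrite wedge_ee disjoints1.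
have -> : m \notin S by apply/negP => /mS; rewrite ltnn.
rewrite /shuffle_sign eq_card0 ?mulr1 ?scale1r // => -[i j]; rewrite !inE /=.
by apply/negP => /and3P[/eqP -> /mS mj]; rewrite ltnNge (ltnW mj).
Qed.

(** Splitting off the least element is what keeps inductions free of signs: by [ext_e_setU1_min] the
    new factor then stands in front with coefficient 1. *)
Lemma set_min_ind (P : {set 'I_n} -> Prop) : P set0 ->
  (forall (m : 'I_n) S, (forall j, j \in S -> (m < j)%N) -> P S -> P (m |: S)) ->
  forall S, P S.
Proof.
move=> P0 PU S; have [k] := ubnP #|S|; elim: k S => // k IH S Sk.
have [->//|/set0Pn[i iS]] := eqVneq S set0.
have [m mS0 mmin] := arg_minnP (@nat_of_ord n) iS.
have mS : m \in S by [].
rewrite -(setD1K mS); apply: PU => [j|].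
  by rewrite !inE => /andP[jm jS]; rewrite ltn_neqAle mmin // andbT eq_sym.
by apply: IH; move: Sk; rewrite (cardsD1 m) mS.
Qed.

Lemma cards_setU1_min (m : 'I_n) S : (forall j, j \in S -> (m < j)%N) ->
  #|m |: S| = #|S|.+1.
Proof.
by move=> mS; rewrite cardsU1 (_ : m \notin S) //; apply/negP => /mS; rewrite ltnn.
Qed.

(** Hides the shuffle sign: the later computations need only that it squares to 1. *)
Lemma wedge_bi_ext (i : 'I_n) S : exists c : R,
  [/\ c * c = 1, i \notin S -> wedge (ext_b i) (ext_e S) = c *: ext_e (i |: S) &
    i \in S -> wedge (ext_b i) (ext_e S) = 0 :> ext R n].
Proof.
exists (shuffle_sign R [set i] S); rewrite shuffle_sign_sq wedge_ee disjoints1.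
by split => // ->; rewrite ?mul1r // mul0r scale0r.
Qed.

Lemma wedge_bb (i : 'I_n) : wedge (ext_b i) (ext_b i) = 0 :> ext R n.
Proof. by have [c [_ _ ->]] := wedge_bi_ext i [set i]; rewrite ?set11. Qed.

Lemma wedge_bC (i j : 'I_n) :
  wedge (ext_b i) (ext_b j) = - wedge (ext_b j) (ext_b i) :> ext R n.
Proof.
wlog ij : i j / (i <= j)%N.
  by move=> H; case: (leqP i j) => [/H//|/ltnW/H ->]; rewrite opprK.
have [<-|neq] := eqVneq i j; first by rewrite wedge_bb oppr0.
rewrite !wedge_ee !disjoints1 !inE neq eq_sym neq !mul1r setUC -scaleNr.
congr (_ *: _); rewrite /shuffle_sign eq_card0 => [|[a b]]; last first.
  by rewrite !inE /=; apply/negP => /and3P[/eqP-> /eqP->]; rewrite ltnNge ij.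
rewrite (_ : #|_| = 1%N) ?expr1 ?opprK //.
rewrite (eq_card (B := pred1 (j, i))) ?card1 // => -[a b].
rewrite !inE /= xpair_eqE; apply/and3P/andP => [[-> -> //]|[/eqP-> /eqP->]].
by rewrite !eqxx ltn_neqAle neq.
Qed.

Lemma ext_vec_wedgeC (u v : 'rV[R]_n) :
  wedge (ext_vec u) (ext_vec v) = - wedge (ext_vec v) (ext_vec u).
Proof.
rewrite /ext_vec !wedge_suml.
under eq_bigr do rewrite wedge_sumr.
under [in RHS]eq_bigr do rewrite wedge_sumr.
rewrite exchange_big -sumrN; apply: eq_bigr => i _.
rewrite -sumrN; apply: eq_bigr => j _.
by rewrite !(wedgeZl, wedgeZr) wedge_bC !scalerN !scalerA mulrC.
Qed.

Lemma ext_vec_wedge_sq (u : 'rV[R]_n) : wedge (ext_vec u) (ext_vec u) = 0.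
Proof.
apply/ffunP => S; move/ffunP/(_ S): (ext_vec_wedgeC u u).
by rewrite [in X in _ = X -> _]ffunE [in X in _ -> _ = X]ffunE; lra.
Qed.

Lemma wedge_bC_homog (i : 'I_n) (l : int) x : homog l x ->
  wedge (ext_b i) x = ((-1) ^ l : R) *: wedge x (ext_b i).
Proof.
have He S : wedge (ext_b i) (ext_e S) =
    ((-1) ^+ #|S| : R) *: wedge (ext_e S) (ext_b i) :> ext R n.
  elim/set_min_ind: S => [|m S mS IH].
    by rewrite wedgex1 wedge1x cards0 scale1r.
  rewrite ext_e_setU1_min // wedgeA wedge_bC wedgeNl -!wedgeA IH wedgeZr.
  by rewrite cards_setU1_min // exprS mulN1r scaleNr.
move=> hx; rewrite (ext_sum x) wedge_sumr wedge_suml scaler_sumr.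
apply: eq_bigr => S _; rewrite wedgeZl wedgeZr.
have [<-|Sl] := eqVneq #|S|%:Z l; last by rewrite hx // !scale0r scaler0.
by rewrite He -exprnP !scalerA mulrC.
Qed.

(** Only [x] is expanded in the basis. Each of the [k] basis vectors of a term then crosses the
    whole of [y], at the cost of [(-1) ^ l]. *)
Lemma wedgeC_homog (k l : int) x y : homog k x -> homog l y ->
  wedge x y = ((-1) ^ (k * l) : R) *: wedge y x.
Proof.
move=> hx hy; rewrite (ext_sum x) wedge_sumr wedge_suml scaler_sumr.
apply: eq_bigr => S _; rewrite wedgeZl wedgeZr.
have [<-|Sk] := eqVneq #|S|%:Z k; last by rewrite hx // !scale0r scaler0.
rewrite scalerA mulrC -scalerA; congr (_ *: _); move: hy; clear.
elim/set_min_ind: S => [hy|m S mS IH hy].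
  by rewrite wedgex1 wedge1x cards0 mul0r scale1r.
rewrite ext_e_setU1_min // cards_setU1_min // -wedgeA IH // wedgeZr wedgeA.
rewrite (wedge_bC_homog m hy) wedgeZl -wedgeA scalerA -signzD.
by congr (_ ^ _ *: _); rewrite intS; ring.
Qed.

(** * The pairing and the interior product *)

Lemma ext_pairDl x y z : ext_pair (x + y) z = ext_pair x z + ext_pair y z.
Proof.
by rewrite /ext_pair -big_split; apply: eq_bigr => S _; rewrite ffunE mulrDl.
Qed.

Lemma ext_pairC x y : ext_pair x y = ext_pair y x.
Proof. by apply: eq_bigr => S _; rewrite mulrC. Qed.

Lemma ext_pairZl c x y : ext_pair (c *: x) y = c * ext_pair x y.
Proof.
rewrite /ext_pair mulr_sumr; apply: eq_bigr => S _.
by rewrite ffunE /GRing.scale /= mulrA.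
Qed.

Lemma ext_pairDr x y z : ext_pair x (y + z) = ext_pair x y + ext_pair x z.
Proof. by rewrite !(ext_pairC x) ext_pairDl. Qed.

Lemma ext_pairZr c x y : ext_pair x (c *: y) = c * ext_pair x y.
Proof. by rewrite !(ext_pairC x) ext_pairZl. Qed.

Lemma ext_pairNl x y : ext_pair (- x) y = - ext_pair x y.
Proof. by rewrite -scaleN1r ext_pairZl mulN1r. Qed.

Lemma ext_pairNr x y : ext_pair x (- y) = - ext_pair x y.
Proof. by rewrite !(ext_pairC x) ext_pairNl. Qed.

Lemma ext_pair0l x : ext_pair 0 x = 0.
Proof. by rewrite /ext_pair big1 // => S _; rewrite ffunE mul0r. Qed.

Lemma ext_pair0r x : ext_pair x 0 = 0.
Proof. by rewrite ext_pairC ext_pair0l. Qed.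

Lemma ext_pair_suml (I : Type) (r : seq I) (P : pred I) (F : I -> ext R n) y :
  ext_pair (\sum_(i <- r | P i) F i) y = \sum_(i <- r | P i) ext_pair (F i) y.
Proof.
exact: (big_morph (fun x => ext_pair x y) (fun a b => ext_pairDl a b y)
  (ext_pair0l y)).
Qed.

Lemma ext_pair_sumr (I : Type) (r : seq I) (P : pred I) (F : I -> ext R n) x :
  ext_pair x (\sum_(i <- r | P i) F i) = \sum_(i <- r | P i) ext_pair x (F i).
Proof. exact: (big_morph (ext_pair x) (ext_pairDr x) (ext_pair0r x)). Qed.

Lemma ext_pair_er x S : ext_pair x (ext_e S) = x S.
Proof.
rewrite /ext_pair (bigD1 S) //= big1 => [|T TS]; rewrite ffunE.
  by rewrite eqxx mulr1 addr0.
by rewrite (negPf TS) mulr0.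
Qed.

Lemma ext_pair_el x S : ext_pair (ext_e S) x = x S.
Proof. by rewrite ext_pairC ext_pair_er. Qed.

Lemma ext_pair_inj x y : (forall z, ext_pair x z = ext_pair y z) -> x = y.
Proof. by move=> H; apply/ffunP => S; rewrite -!ext_pair_er. Qed.

Lemma ext_pair_homog_eq0 (k l : int) x y :
  homog k x -> homog l y -> k != l -> ext_pair x y = 0.
Proof.
move=> hx hy kl; rewrite /ext_pair big1 // => S _.
have [Sk|Sk] := eqVneq #|S|%:Z k; last by rewrite hx // mul0r.
by rewrite hy ?mulr0 // Sk.
Qed.

(** With [ext_pair_inj], this adjunction turns identities for [contract] into identities for
    [wedge], without coordinates. *)
Lemma ext_pair_contract x w y :
  ext_pair (contract x w) y = ext_pair w (wedge x y).
Proof.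
rewrite [in RHS](ext_sum y) wedge_sumr ext_pair_sumr; apply: eq_bigr => S _.
by rewrite wedgeZr ext_pairZr ffunE mulrC.
Qed.

Lemma contractDl x y w : contract (x + y) w = contract x w + contract y w.
Proof.
apply: ext_pair_inj => z.
by rewrite ext_pairDl !ext_pair_contract wedgeDl ext_pairDr.
Qed.

Lemma contractDr x w v : contract x (w + v) = contract x w + contract x v.
Proof.
by apply: ext_pair_inj => z; rewrite ext_pairDl !ext_pair_contract ext_pairDl.
Qed.

Lemma contractZl c x w : contract (c *: x) w = c *: contract x w.
Proof.
apply: ext_pair_inj => z.
by rewrite ext_pairZl !ext_pair_contract wedgeZl ext_pairZr.
Qed.

Lemma contractZr c x w : contract x (c *: w) = c *: contract x w.
Proof.
by apply: ext_pair_inj => z; rewrite ext_pairZl !ext_pair_contract ext_pairZl.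
Qed.

Lemma contract0l w : contract 0 w = 0.
Proof. by apply: (addrI (contract 0 w)); rewrite -contractDl !addr0. Qed.

Lemma contract0r x : contract x 0 = 0.
Proof. by apply: (addrI (contract x 0)); rewrite -contractDr !addr0. Qed.

Lemma contract_suml (I : Type) (r : seq I) (P : pred I) (F : I -> ext R n) w :
  contract (\sum_(i <- r | P i) F i) w = \sum_(i <- r | P i) contract (F i) w.
Proof.
exact: (big_morph (fun x => contract x w) (fun a b => contractDl a b w)
  (contract0l w)).
Qed.

Lemma contract_sumr (I : Type) (r : seq I) (P : pred I) (F : I -> ext R n) x :
  contract x (\sum_(i <- r | P i) F i) = \sum_(i <- r | P i) contract x (F i).
Proof. exact: (big_morph (contract x) (contractDr x) (contract0r x)). Qed.

Lemma contract_contract x y w :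
  contract x (contract y w) = contract (wedge y x) w.
Proof. by apply: ext_pair_inj => z; rewrite !ext_pair_contract wedgeA. Qed.

Lemma homog_contract (k l : int) x w :
  homog k x -> homog l w -> homog (l - k) (contract x w).
Proof.
move=> hx hw S Sk; rewrite ffunE.
rewrite (ext_pair_homog_eq0 hw (homog_wedge hx (homog_e (S := S)))) //.
by apply: contra Sk => /eqP ->; rewrite addrC addKr.
Qed.

Lemma contract_same_homog (k : int) x w : homog k x -> homog k w ->
  contract x w = ext_pair w x *: ext_1.
Proof.
move=> hx hw; rewrite [LHS]homog0E; last by rewrite -(subrr k); exact: homog_contract.
by rewrite ffunE wedgex1.
Qed.

Lemma contract_bi_ext (i : 'I_n) S : i \notin S ->
  contract (ext_b i) (ext_e S) = 0 :> ext R n.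
Proof.
move=> iS; apply/ffunP => T; rewrite ffunE ext_pair_el wedge_ee !ffunE.
have [SE|_] := eqVneq S ([set i] :|: T); last exact: mulr0.
by rewrite SE !inE eqxx in iS.
Qed.

Lemma contract_b_wedge_b (i : 'I_n) S : i \notin S ->
  contract (ext_b i) (wedge (ext_b i) (ext_e S)) = ext_e S :> ext R n.
Proof.
move=> iS; apply/ffunP => T; rewrite ffunE !wedge_ee ext_pairZl ext_pairZr.
rewrite ext_pair_er !ffunE !disjoints1 iS.
have [->|TS] := eqVneq T S.
  by rewrite iS eqxx !mul1r mulr1 shuffle_sign_sq.
have [iT|iT] := boolP (i \in T); first by rewrite /=; ring.
have [SE|_] := eqVneq ([set i] :|: T) ([set i] :|: S); last by rewrite /=; ring.
case/eqP: TS; apply/setP => j; move/setP/(_ j): SE; rewrite !inE.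
by have [->|_ //] := eqVneq j i; rewrite (negPf iS) (negPf iT).
Qed.

(* The relation between creation and annihilation operators on a fermionic Fock
   space. *)
Lemma contract_b_wedge (i j : 'I_n) x :
  contract (ext_b i) (wedge (ext_b j) x) =
    (i == j)%:R *: x - wedge (ext_b j) (contract (ext_b i) x).
Proof.
elim/ext_ind: x => [|x y Hx Hy|c x Hx|S].
- by rewrite !(wedge0r, contract0r) scaler0 subr0.
- by rewrite !(wedgeDr, contractDr) Hx Hy scalerDr opprD addrACA.
- by rewrite !(wedgeZr, contractZr) Hx scalerBr !scalerA [c * _]mulrC.
have [iS|iS] := boolP (i \in S); last first.
  rewrite (contract_bi_ext iS) wedge0r subr0.
  have [<-|ij] := eqVneq i j; first by rewrite contract_b_wedge_b // scale1r.
  rewrite scale0r; have [c [_ H1 H2]] := wedge_bi_ext j S.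
  have [jS|jS] := boolP (j \in S); first by rewrite H2 // contract0r.
  by rewrite H1 // contractZr contract_bi_ext ?scaler0 // !inE negb_or ij.
have iT : i \notin S :\ i by rewrite !inE eqxx.
have [c [cc H1 _]] := wedge_bi_ext i (S :\ i).
have -> : ext_e S = c *: wedge (ext_b i) (ext_e (S :\ i)) :> ext R n.
  by rewrite H1 // scalerA cc scale1r setD1K.
rewrite !(wedgeZr, contractZr) contract_b_wedge_b //.
rewrite [RHS](_ : _ = c *: ((i == j)%:R *: wedge (ext_b i) (ext_e (S :\ i))
   - wedge (ext_b j) (ext_e (S :\ i)))); last by rewrite scalerBr !scalerA [c * _]mulrC.
congr (_ *: _); have [<-|ij] := eqVneq i j.
  by rewrite wedgeA wedge_bb wedge0l contract0r scale1r subrr.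
rewrite scale0r sub0r wedgeA wedge_bC wedgeNl -wedgeA -scaleN1r contractZr scaleN1r.
have [d [_ H1' H2']] := wedge_bi_ext j (S :\ i).
congr (- _); have [jS|jS] := boolP (j \in S :\ i).
  by rewrite H2' // wedge0r contract0r.
rewrite H1' // wedgeZr contractZr contract_b_wedge_b //.
by rewrite !inE negb_or ij eqxx.
Qed.

(** Contraction by an element of degree 1 is an antiderivation. It is used with [a] a tangent vector
    acting on forms, for Cartan's formula, and with [a] the differential of a function acting on
    multivectors, for the bracket. *)
Lemma contract_wedge_homog1 (a v : ext R n) x : homog 1 a -> homog 1 v ->
  contract a (wedge v x) = ext_pair a v *: x - wedge v (contract a x).
Proof.
move=> /homog1E -> /homog1E ->.
rewrite wedge_suml !contract_suml ext_pair_suml scaler_suml wedge_sumr -sumrB.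
apply: eq_bigr => i _; rewrite contract_sumr ext_pair_sumr scaler_suml wedge_suml.
rewrite -sumrB; apply: eq_bigr => j _.
rewrite !(contractZl, contractZr, wedgeZl, wedgeZr, ext_pairZl, ext_pairZr).
rewrite contract_b_wedge ext_pair_er ffunE scalerBr !scalerA scalerBr !scalerA.
rewrite (inj_eq set1_inj) eq_sym.
by congr (_ *: _ - _ *: _); exact: mulrC.
Qed.

(** * Functoriality of the exterior algebra *)

Lemma ext_pushD (J : 'M[R]_n) x y :
  ext_push J (x + y) = ext_push J x + ext_push J y.
Proof.
by rewrite /ext_push -big_split; apply: eq_bigr => S _; rewrite ffunE scalerDl.
Qed.

Lemma ext_pushZ (J : 'M[R]_n) c x : ext_push J (c *: x) = c *: ext_push J x.
Proof.
by rewrite /ext_push scaler_sumr; apply: eq_bigr => S _; rewrite ffunE scalerA.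
Qed.

Lemma ext_push0 (J : 'M[R]_n) : ext_push J 0 = 0.
Proof. by apply: (addrI (ext_push J 0)); rewrite -ext_pushD !addr0. Qed.

Lemma ext_push_sum (J : 'M[R]_n) (I : Type) (r : seq I) (P : pred I)
    (F : I -> ext R n) :
  ext_push J (\sum_(i <- r | P i) F i) = \sum_(i <- r | P i) ext_push J (F i).
Proof. exact: (big_morph _ (ext_pushD J) (ext_push0 J)). Qed.

Lemma ext_push_e (J : 'M[R]_n) S : ext_push J (ext_e S) =
  \big[wedge/ext_1]_(i <- enum S) ext_vec (row i J).
Proof.
rewrite /ext_push (bigD1 S) //= big1 => [|T TS]; rewrite ffunE.
  by rewrite eqxx scale1r addr0.
by rewrite (negPf TS) scale0r.
Qed.

Lemma ext_push_1 (J : 'M[R]_n) : ext_push J ext_1 = ext_1.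
Proof. by rewrite ext_push_e enum_set0 big_nil. Qed.

Lemma ext_push_b (J : 'M[R]_n) i : ext_push J (ext_b i) = ext_vec (row i J).
Proof. by rewrite ext_push_e enum_set1 big_cons big_nil wedgex1. Qed.

Lemma ext_push_e_min (J : 'M[R]_n) (m : 'I_n) S :
  (forall j, j \in S -> (m < j)%N) ->
  ext_push J (ext_e (m |: S)) = wedge (ext_vec (row m J)) (ext_push J (ext_e S)).
Proof. by move=> mS; rewrite !ext_push_e enum_setU1_min // big_cons. Qed.

(** The core of multiplicativity. [ext_push] is given by increasing products only, so [e_i] has to
    be sorted into [S]. The rows of [J] anticommute and square to zero exactly as basis vectors do,
    so both sides follow the same moves. *)
Lemma ext_push_wedge_b (J : 'M[R]_n) (i : 'I_n) x :
  ext_push J (wedge (ext_b i) x) = wedge (ext_vec (row i J)) (ext_push J x).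
Proof.
elim/ext_ind: x => [|x y Hx Hy|c x Hx|S].
- by rewrite !(wedge0r, ext_push0).
- by rewrite !(wedgeDr, ext_pushD) Hx Hy.
- by rewrite !(wedgeZr, ext_pushZ) Hx.
elim/set_min_ind: S => [|m S mS IH].
  by rewrite ext_push_1 !wedgex1 ext_push_b.
have [im|mi|/val_inj ->] := ltngtP i m.
- have imS j : j \in m |: S -> (i < j)%N.
    by rewrite in_setU1 => /predU1P[->//|/mS]; exact: ltn_trans.
  by rewrite -(ext_e_setU1_min imS) (ext_push_e_min _ imS).
- rewrite ext_e_setU1_min // wedgeA wedge_bC wedgeNl -wedgeA.
  rewrite -scaleN1r ext_pushZ scaleN1r.
  (* Since [m < i], the index [m] lies below all of [i |: S]; up to a scalar, the inner product is
     the basis element of that set or zero, so [e_m] splits off in front. *)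
  have -> : ext_push J (wedge (ext_b m) (wedge (ext_b i) (ext_e S))) =
      wedge (ext_vec (row m J)) (ext_push J (wedge (ext_b i) (ext_e S))).
    have [c [_ H1 H2]] := wedge_bi_ext i S.
    have [iS|iS] := boolP (i \in S).
      by rewrite H2 // !(ext_push0, wedge0r).
    have miS j : j \in i |: S -> (m < j)%N.
      by rewrite in_setU1 => /predU1P[->//|/mS].
    rewrite H1 // !(wedgeZr, ext_pushZ) -(ext_e_setU1_min miS).
    by rewrite (ext_push_e_min _ miS).
  by rewrite IH -ext_e_setU1_min // ext_push_e_min // !wedgeA -wedgeNl -ext_vec_wedgeC.
rewrite ext_push_e_min // ext_e_setU1_min // !wedgeA ext_vec_wedge_sq.
by rewrite wedge_bb !wedge0l ext_push0.
Qed.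

Lemma ext_push_wedge (J : 'M[R]_n) x y :
  ext_push J (wedge x y) = wedge (ext_push J x) (ext_push J y).
Proof.
elim/ext_ind: x => [|x z Hx Hz|c x Hx|S].
- by rewrite !(wedge0l, ext_push0).
- by rewrite !(wedgeDl, ext_pushD) Hx Hz.
- by rewrite !(wedgeZl, ext_pushZ) Hx.
elim/set_min_ind: S => [|m S mS IH]; first by rewrite ext_push_1 !wedge1x.
rewrite ext_e_setU1_min // -wedgeA !ext_push_wedge_b IH.
by rewrite wedgeA.
Qed.

Lemma ext_push_vec (J : 'M[R]_n) (v : 'rV[R]_n) :
  ext_push J (ext_vec v) = ext_vec (v *m J).
Proof.
rewrite /ext_vec ext_push_sum.
under eq_bigr do rewrite ext_pushZ ext_push_b /ext_vec scaler_sumr.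
rewrite exchange_big /=; apply: eq_bigr => j _.
rewrite mxE scaler_suml; apply: eq_bigr => i _.
by rewrite scalerA mxE.
Qed.

Lemma ext_push_push (J K : 'M[R]_n) x :
  ext_push J (ext_push K x) = ext_push (K *m J) x.
Proof.
elim/ext_ind: x => [|x z Hx Hz|c x Hx|S].
- by rewrite !ext_push0.
- by rewrite !ext_pushD Hx Hz.
- by rewrite !ext_pushZ Hx.
elim/set_min_ind: S => [|m S mS IH]; first by rewrite !ext_push_1.
by rewrite !ext_push_e_min // ext_push_wedge ext_push_vec IH row_mul.
Qed.

Lemma ext_push_id x : ext_push 1%:M x = x.
Proof.
elim/ext_ind: x => [|x z Hx Hz|c x Hx|S].
- by rewrite !ext_push0.
- by rewrite !ext_pushD Hx Hz.
- by rewrite !ext_pushZ Hx.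
elim/set_min_ind: S => [|m S mS IH]; first by rewrite !ext_push_1.
rewrite ext_push_e_min // IH ext_e_setU1_min //; congr wedge.
rewrite /ext_vec (bigD1 m) //= big1 => [|j jm]; rewrite !mxE.
  by rewrite eqxx scale1r addr0.
by rewrite eq_sym (negPf jm) scale0r.
Qed.

Lemma homog_push (J : 'M[R]_n) (k : int) x : homog k x -> homog k (ext_push J x).
Proof.
have He S : homog #|S| (ext_push J (ext_e S)).
  elim/set_min_ind: S => [|m S mS IH].
    by rewrite ext_push_1 cards0; exact: homog_1.
  rewrite cards_setU1_min // ext_push_e_min // intS; apply: homog_wedge => //.
  by apply: homog_sum => i _; apply: homogZ; exact: homog_b.
move=> hx; rewrite (ext_sum x) ext_push_sum; apply: homog_sum => S _.
rewrite ext_pushZ; have [<-|Sk] := eqVneq #|S|%:Z k; first exact/homogZ/He.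
by rewrite hx // scale0r; exact: homog0.
Qed.

Lemma ext_pair_pull (J : 'M[R]_n) w x :
  ext_pair (ext_pull J w) x = ext_pair w (ext_push J x).
Proof.
rewrite [in RHS](ext_sum x) ext_push_sum ext_pair_sumr; apply: eq_bigr => S _.
by rewrite ext_pushZ ext_pairZr ffunE mulrC.
Qed.

Lemma ext_pullD (J : 'M[R]_n) w v :
  ext_pull J (w + v) = ext_pull J w + ext_pull J v.
Proof.
by apply: ext_pair_inj => z; rewrite ext_pairDl !ext_pair_pull ext_pairDl.
Qed.

Lemma ext_pullZ (J : 'M[R]_n) c w : ext_pull J (c *: w) = c *: ext_pull J w.
Proof.
by apply: ext_pair_inj => z; rewrite ext_pairZl !ext_pair_pull ext_pairZl.
Qed.

Lemma ext_pull0 (J : 'M[R]_n) : ext_pull J 0 = 0.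
Proof. by apply: (addrI (ext_pull J 0)); rewrite -ext_pullD !addr0. Qed.

Lemma ext_pull_pull (J K : 'M[R]_n) w :
  ext_pull J (ext_pull K w) = ext_pull (J *m K) w.
Proof.
by apply: ext_pair_inj => z; rewrite !ext_pair_pull ext_push_push.
Qed.

Lemma ext_pull_id w : ext_pull 1%:M w = w.
Proof. by apply: ext_pair_inj => z; rewrite ext_pair_pull ext_push_id. Qed.

Lemma homog_pull (J : 'M[R]_n) (k : int) w : homog k w -> homog k (ext_pull J w).
Proof.
move=> hw S Sk; rewrite ffunE.
rewrite (ext_pair_homog_eq0 hw (homog_push J (homog_e (S := S)))) //.
by rewrite eq_sym.
Qed.

Lemma contract_pull (J : 'M[R]_n) x w :
  contract x (ext_pull J w) = ext_pull J (contract (ext_push J x) w).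
Proof.
apply: ext_pair_inj => z.
by rewrite ext_pair_contract !ext_pair_pull ext_pair_contract ext_push_wedge.
Qed.

End ExteriorAlgebra.

From mathcomp Require Import all_classical all_reals all_analysis.
Import numFieldNormedType.Exports.
Local Open Scope classical_set_scope.
Local Open Scope ring_scope.

(** * Smooth functions on open subsets of [R^n] *)

(** It is enough to treat [g - f], which vanishes near [x]: its expansion with zero differential has
    zero remainder there, and [diff_unique] identifies the differential with that zero map. *)
Lemma near_eq_differentiable (R : numFieldType) (V W : normedModType R)
    (f g : V -> W) (x : V) :
  (\forall y \near x, f y = g y) -> differentiable f x -> differentiable g x.
Proof.
move=> fg df.
have h0 : \forall y \near x, (g - f) y = 0.
  by apply: filterS fg => y fgy; rewrite -[LHS]/(g y - f y) fgy subrr.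
suff dgf : differentiable (g - f) x.
  by rewrite -(subrK f g); exact: differentiableD.
have h1 : (g - f) \o shift x = cst ((g - f) x) + (\0 : V -> W) +o_ 0 id.
  apply/eqaddoP => _/posnumP[e].
  rewrite (nbhs_singleton h0).
  have := h0; rewrite (near_shift 0) /= subr0.
  apply: filterS => y; rewrite /= => hy.
  rewrite (_ : (_ - _) y = 0) ?normr0 ?mulr_ge0 //.
  by rewrite -[LHS]/((g - f) (y + x) - (0 + 0)) hy addr0 subrr.
have d0 : 'd (g - f) x = \0 :> (V -> W).
  by apply: diff_unique => //; by move=> y; exact: cvg_cst.
apply/diff_locallyP; rewrite d0; split => //; by move=> y; exact: cvg_cst.
Qed.

Section SmoothFunctions.
Context {R : realType} {n : nat}.
Implicit Types (U V : set 'rV[R]_n) (f g : 'rV[R]_n -> R) (x : 'rV[R]_n).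

Local Notation "''d_' i f" := (fun x => 'D_(delta_mx 0 i) f x)
  (at level 10, i at level 0, f at next level).

(** A finite order gives closure properties an induction: the derivative of a product, inverse or
    composite involves the original functions again, but is needed to one order less. *)
Definition smooth_upto (k : nat) U f : Prop :=
  forall (s : seq 'I_n), (size s <= k)%N -> forall x, U x ->
    differentiable (iter_partial s f : 'rV[R]_n -> R) x.

Lemma iter_partial_rcons (s : seq 'I_n) i f :
  iter_partial (rcons s i) f = iter_partial s ('d_ i f).
Proof. exact: foldr_rcons. Qed.

Lemma smooth_onP U f : smooth_on U f <-> forall k, smooth_upto k U f.
Proof.
split=> [sf k s _ x|sf s x Ux]; first exact: sf.
exact: (sf (size s)).
Qed.

Lemma smooth_upto_diff k U f x : smooth_upto k U f -> U x -> differentiable f x.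
Proof. by move=> sf Ux; exact: (sf [::]). Qed.

(** The derivative split off is the innermost one, the last index of the list. It falls on [f]
    itself, where the product and chain rules are available. *)
Lemma smooth_uptoSP k U f : smooth_upto k.+1 U f <->
  (forall x, U x -> differentiable f x) /\ forall i, smooth_upto k U ('d_ i f).
Proof.
split=> [sf|[df sf] s].
  split=> [x|i s sk x Ux]; first exact: smooth_upto_diff sf.
  by rewrite -iter_partial_rcons; apply: sf => //; rewrite size_rcons.
elim/last_ind: s => [_ //|s i _]; rewrite size_rcons ltnS => sk x Ux.
by rewrite iter_partial_rcons; exact: sf.
Qed.

Lemma smooth_uptoW k U f : smooth_upto k.+1 U f -> smooth_upto k U f.
Proof. by move=> sf s sk; apply: sf; exact: leqW. Qed.

Lemma near_open U f g x : open U -> U x -> (forall y, U y -> f y = g y) ->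
  \forall y \near x, f y = g y.
Proof.
by move=> oU Ux fg; apply: filterS fg _; apply: open_nbhs_nbhs; split.
Qed.

(** The rules of differentiation are known only at points of [U], while [iter_partial]
    differentiates total functions. Openness turns equality on [U] into equality near each of its
    points, which passes to derivatives. *)
Lemma eq_smooth_upto k U f g : open U -> (forall x, U x -> f x = g x) ->
  smooth_upto k U f -> smooth_upto k U g.
Proof.
move=> oU; elim: k f g => [|k IH] f g fg sf.
  move=> [|//] _ x Ux; apply: near_eq_differentiable (near_open oU Ux fg) _.
  exact: smooth_upto_diff sf Ux.
move/smooth_uptoSP: sf => [df sf]; apply/smooth_uptoSP; split=> [x Ux|i].
  exact: near_eq_differentiable (near_open oU Ux fg) (df _ Ux).
apply: IH (sf i) => x Ux; apply: near_eq_derive; exact: near_open Ux fg.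
Qed.

Lemma smooth_upto_cst k U (c : R) : smooth_upto k U (fun=> c).
Proof.
have cst_it (s : seq 'I_n) : exists c' : R, iter_partial s (fun=> c) = cst c'.
  elim: s => [|i s [c' IH]]; first by exists c.
  by exists 0; rewrite /= IH; apply/funext => x; rewrite derive_cst.
move=> s _ x _; have [c' ->] := cst_it s; exact: differentiable_cst.
Qed.

Lemma smooth_uptoD k U f g : open U -> smooth_upto k U f -> smooth_upto k U g ->
  smooth_upto k U (fun x => f x + g x).
Proof.
move=> oU; elim: k f g => [|k IH] f g sf sg.
  move=> [|//] _ x Ux.
  apply: differentiableD; [exact: smooth_upto_diff sf Ux|exact: smooth_upto_diff sg Ux].
have [/smooth_uptoSP [df sf'] /smooth_uptoSP [dg sg']] := (sf, sg).
apply/smooth_uptoSP; split=> [x Ux|i]; first by apply: differentiableD; auto.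
apply: eq_smooth_upto (IH _ _ (sf' i) (sg' i)) => // x Ux.
by rewrite [RHS]deriveD //; apply: diff_derivable; auto.
Qed.

Lemma smooth_uptoM k U f g : open U -> smooth_upto k U f -> smooth_upto k U g ->
  smooth_upto k U (fun x => f x * g x).
Proof.
move=> oU; elim: k f g => [|k IH] f g sf sg.
  move=> [|//] _ x Ux.
  apply: differentiableM; [exact: smooth_upto_diff sf Ux|exact: smooth_upto_diff sg Ux].
have [/smooth_uptoSP [df sf'] /smooth_uptoSP [dg sg']] := (sf, sg).
apply/smooth_uptoSP; split=> [x Ux|i]; first by apply: differentiableM; auto.
have := smooth_uptoD oU (IH _ _ (smooth_uptoW sf) (sg' i))
  (IH _ _ (smooth_uptoW sg) (sf' i)).
apply: eq_smooth_upto => // x Ux.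
by rewrite [RHS]deriveM //; apply: diff_derivable; auto.
Qed.

Lemma smooth_upto_sum k U (I : Type) (r : seq I) (P : pred I)
    (F : I -> 'rV[R]_n -> R) :
  open U -> (forall i, P i -> smooth_upto k U (F i)) ->
  smooth_upto k U (fun x => \sum_(i <- r | P i) F i x).
Proof.
move=> oU sF; elim: r => [|i r IH].
  by apply: eq_smooth_upto (@smooth_upto_cst k U 0) => // x _; rewrite big_nil.
have [Pi|Pi] := boolP (P i).
  apply: eq_smooth_upto (smooth_uptoD oU (sF i Pi) IH) => // x _.
  by rewrite big_cons Pi.
by apply: eq_smooth_upto IH => // x _; rewrite big_cons (negPf Pi).
Qed.

Lemma smooth_uptoV k U f : open U -> (forall x, U x -> f x != 0) ->
  smooth_upto k U f -> smooth_upto k U (fun x => (f x)^-1).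
Proof.
move=> oU f0; elim: k => [|k IH] sf.
  move=> [|//] _ x Ux; apply: differentiableV; last exact: f0.
  exact: smooth_upto_diff sf Ux.
have /smooth_uptoSP [df sf'] := sf.
apply/smooth_uptoSP; split=> [x Ux|i]; first by apply: differentiableV; auto.
have sV := IH (smooth_uptoW sf).
(* The derivative of [1 / f] is written [-1 * ((1 / f) * (1 / f) * f')], so that the induction
   hypothesis covers the inverses. *)
have := smooth_uptoM oU (@smooth_upto_cst k U (-1))
  (smooth_uptoM oU (smooth_uptoM oU sV sV) (sf' i)).
apply: eq_smooth_upto => // x Ux.
rewrite [RHS](@deriveV _ _ f) ?f0 //; last by apply: diff_derivable; auto.
by rewrite mulN1r expr2 invfM /GRing.scale /= mulNr.
Qed.

Lemma diff_coord (phi : 'rV[R]_n -> 'rV[R]_n) x j v :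
  differentiable phi x ->
  'd (fun y => phi y 0 j : R) x v = 'd phi x v 0 j.
Proof.
have [c cE cc] : exists2 c : {linear 'rV[R]_n -> R},
    (forall N, c N = N 0 j) & continuous c.
  have @c : {linear 'rV[R]_n -> R}.
    by exists (fun N : 'rV[R]_n => N 0 j); do 2![eexists]; do ?[constructor];
       rewrite ?mxE// => ? *; rewrite ?mxE//; move=> ?; rewrite !mxE.
  by exists c => // y; exact: coord_continuous.
move=> dphi; rewrite (_ : (fun y => phi y 0 j) = c \o phi); last first.
  by apply/funext => y /=; rewrite cE.
rewrite diff_comp ?[LHS]/= ?diff_lin ?cE //.
exact: linear_differentiable.
Qed.

Lemma differentiable_row (phi : 'rV[R]_n -> 'rV[R]_n) x :
  (forall j, differentiable (fun y => phi y 0 j : R) x) -> differentiable phi x.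
Proof.
move=> dphi.
rewrite (_ : phi = \sum_(j < n) (fun y => phi y 0 j *: (delta_mx 0 j : 'rV[R]_n))).
  by apply: differentiable_sum => j; exact: differentiableZl.
apply/funext => y; rewrite fct_sumE [LHS]row_sum_delta.
by apply: eq_bigr.
Qed.

Lemma derive_comp_row (phi : 'rV[R]_n -> 'rV[R]_n) f x v :
  differentiable phi x -> differentiable f (phi x) ->
  'D_v (fun y => f (phi y)) x =
    \sum_j 'D_(delta_mx 0 j) f (phi x) * 'D_v (fun y => phi y 0 j) x.
Proof.
move=> dphi df; have dc := differentiable_comp dphi df.
rewrite [LHS](deriveE _ dc) diff_comp //=.
rewrite [X in 'd f _ X]row_sum_delta linear_sum; apply: eq_bigr => j _.
rewrite linearZ /= deriveE // -deriveE // mulrC; congr (_ * _).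
rewrite deriveE ?diff_coord //.
exact: (@differentiable_comp _ _ _ _ phi (fun N => N 0 j : R) x dphi
  (differentiable_coord _ _ _)).
Qed.

Lemma smooth_upto_comp k U V (phi : 'rV[R]_n -> 'rV[R]_n) f :
  open U -> (forall x, U x -> V (phi x)) ->
  (forall j, smooth_upto k U (fun x => phi x 0 j)) -> smooth_upto k V f ->
  smooth_upto k U (fun x => f (phi x)).
Proof.
move=> oU UV; elim: k f => [|k IH] f sphi sf.
  move=> [|//] _ x Ux; apply: (@differentiable_comp _ _ _ _ phi f).
    by apply: differentiable_row => j; exact: smooth_upto_diff (sphi j) Ux.
  exact: smooth_upto_diff sf (UV _ Ux).
have dphi x : U x -> differentiable phi x.
  by move=> Ux; apply: differentiable_row => j; exact: smooth_upto_diff (sphi j) Ux.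
have sphi' j : smooth_upto k U (fun x => phi x 0 j) by exact: smooth_uptoW.
have /smooth_uptoSP [df sf'] := sf.
apply/smooth_uptoSP; split=> [x Ux|i].
  by apply: (@differentiable_comp _ _ _ _ phi f); auto.
apply: (@eq_smooth_upto _ _ (fun x => \sum_j
  'D_(delta_mx 0 j) f (phi x) * 'D_(delta_mx 0 i) (fun y => phi y 0 j) x)) => //.
  by move=> x Ux; rewrite derive_comp_row; auto.
apply: smooth_upto_sum => // j _; apply: smooth_uptoM => //.
  exact: (IH ('d_ j f) sphi' (sf' j)).
by have /smooth_uptoSP [_] := sphi j; apply.
Qed.

Lemma eq_smooth_on U f g : open U -> (forall x, U x -> f x = g x) ->
  smooth_on U f -> smooth_on U g.
Proof.
move=> oU fg /smooth_onP sf; apply/smooth_onP => k.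
exact: eq_smooth_upto (sf k).
Qed.

Lemma smooth_on_sub U V f : U `<=` V -> smooth_on V f -> smooth_on U f.
Proof. by move=> UV sf s x /UV; exact: sf. Qed.

Lemma smooth_on_cst U (c : R) : smooth_on U (fun=> c).
Proof. by apply/smooth_onP => k; exact: smooth_upto_cst. Qed.

Lemma smooth_onD U f g : open U -> smooth_on U f -> smooth_on U g ->
  smooth_on U (fun x => f x + g x).
Proof.
by move=> oU /smooth_onP sf /smooth_onP sg; apply/smooth_onP => k; exact: smooth_uptoD.
Qed.

Lemma smooth_onM U f g : open U -> smooth_on U f -> smooth_on U g ->
  smooth_on U (fun x => f x * g x).
Proof.
by move=> oU /smooth_onP sf /smooth_onP sg; apply/smooth_onP => k; exact: smooth_uptoM.
Qed.

Lemma smooth_onV U f : open U -> (forall x, U x -> f x != 0) -> smooth_on U f ->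
  smooth_on U (fun x => (f x)^-1).
Proof.
by move=> oU f0 /smooth_onP sf; apply/smooth_onP => k; exact: smooth_uptoV.
Qed.

Lemma smooth_on_comp U V (phi : 'rV[R]_n -> 'rV[R]_n) f :
  open U -> (forall x, U x -> V (phi x)) ->
  (forall j, smooth_on U (fun x => phi x 0 j)) -> smooth_on V f ->
  smooth_on U (fun x => f (phi x)).
Proof.
move=> oU UV sphi /smooth_onP sf; apply/smooth_onP => k.
apply: smooth_upto_comp (sf k) => // j.
by have /smooth_onP := sphi j; apply.
Qed.

Lemma smooth_on_derive U f i : smooth_on U f -> smooth_on U ('d_ i f).
Proof. by move=> sf s x Ux; rewrite -iter_partial_rcons; exact: sf. Qed.

Lemma smooth_on_coord U j : open U -> smooth_on U (fun x => x 0 j).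
Proof.
move=> oU; apply/smooth_onP => -[|k].
  by move=> [|//] _ x Ux; exact: differentiable_coord.
apply/smooth_uptoSP; split=> [x Ux|i]; first exact: differentiable_coord.
apply: eq_smooth_upto (@smooth_upto_cst k U ((delta_mx 0 i : 'rV[R]_n) 0 j)) => // x Ux.
rewrite deriveE ?(@diff_coord id) //; last exact: differentiable_coord.
by rewrite (@diff_val _ _ _ _ _ id id).
Qed.

End SmoothFunctions.

(** * The flat function on the real line *)

Section Bump.
Context {R : realType}.

(* The family is closed under differentiation, and [flat 0] is the usual flat
   function [exp (- 1 / t)]. *)
Definition flat (m : nat) (t : R) : R :=
  if 0 < t then t ^- m * expR (- t^-1) else 0.

Lemma flat_ge0 m t : 0 <= flat m t.
Proof.
rewrite /flat; case: ifP => // t0.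
by rewrite mulr_ge0 ?expR_ge0 // invr_ge0 exprn_ge0 // ltW.
Qed.

Lemma flat0_gt0 t : 0 < t -> 0 < flat 0 t.
Proof. by rewrite /flat => ->; rewrite expr0 invr1 mul1r expR_gt0. Qed.

(** With [u = 1 / t], the exponential series gives [u ^ (m + 1) / (m + 1)! <= exp u]. The exponent
    [m + 1] is chosen to leave one factor [t], so that [flat m] tends to 0 at the origin. *)
Lemma flat_le m t : flat m t <= m.+1`!%:R * `|t|.
Proof.
rewrite /flat; case: ifP => [t0|_]; last by rewrite mulr_ge0.
rewrite gtr0_norm // expRN.
have u0 : 0 < t^-1 by rewrite invr_gt0.
have f0 : (0 : R) < m.+1`!%:R by rewrite ltr0n fact_gt0.
have H : t^-1 ^+ m.+1 / m.+1`!%:R <= expR t^-1.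
  by apply: le_trans (expR_ge1Dxn m (ltW u0)); rewrite lerDr.
have H' : (expR t^-1)^-1 <= m.+1`!%:R * t ^+ m.+1.
  rewrite -[leRHS]invrK lef_pV2 ?posrE ?expR_gt0 //; last first.
    by rewrite invr_gt0 mulr_gt0 // exprn_gt0.
  by rewrite invfM mulrC -exprVn.
rewrite mulrC ler_pdivrMr ?exprn_gt0 //; apply: le_trans H' _.
by rewrite exprS mulrA.
Qed.

Lemma is_derive_flat m (t : R) :
  is_derive t (1 : R) (flat m) (flat m.+2 t - m%:R * flat m.+1 t).
Proof.
have [t0|t0|->] := ltgtP t 0.
- have E : \forall s \near t, (cst 0 : R -> R) s = flat m s.
    near=> s; rewrite /flat ifF //; apply/negbTE; rewrite -leNgt ltW //.
    by near: s; exact: lt_nbhsl.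
  apply: near_eq_is_derive E _.
  rewrite /flat ltNge (ltW t0) /= mulr0 subr0; exact: is_derive_cst.
- have E : \forall s \near t, s ^- m * expR (- s^-1) = flat m s.
    near=> s; rewrite /flat ifT //; near: s; exact: lt_nbhsr.
  apply: near_eq_is_derive E _.
  have tn0 : t != 0 by rewrite gt_eqF.
  have dV : is_derive t (1 : R) (fun s : R => s^-1) (- t ^- 2).
    apply: is_derive_eq; first exact: (@is_deriveV _ id t 1 1).
    by rewrite /GRing.scale /= mulr1.
  have dX : is_derive t (1 : R) (fun s : R => s ^- m) (- (m%:R * t ^- m.+1)).
    rewrite (_ : (fun s : R => s ^- m) = (fun s : R => s^-1) ^+ m); last first.
      by apply/funext => s; rewrite fctE exprVn.
    case: m => [|m]; first by rewrite expr0 mul0r oppr0; exact: is_derive_cst.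
    apply: is_derive_eq.
    by rewrite /GRing.scale /= !exprVn mulrN -mulrA -invfM -exprD addn2.
  have dE : is_derive t (1 : R) (fun s : R => expR (- s^-1)) (t ^- 2 * expR (- t^-1)).
    have dN : is_derive t (1 : R) (fun s : R => - s^-1) (t ^- 2).
      by apply: is_derive_eq; rewrite opprK.
    apply: is_derive_eq; exact: mulrC.
  apply: is_derive_eq.
  rewrite /flat t0 /GRing.scale /= mulrA -invfM -exprD addn2; ring.
have E0 k : flat k (0 : R) = 0 by rewrite /flat ltxx.
(* At the origin the difference quotient of [flat m] is [flat m.+1], which tends to 0 by
   [flat_le]. *)
have L : (fun h : R => h^-1 *: ((flat m \o shift 0) (h *: 1) - flat m 0)) @ 0^' --> (0 : R).
  apply/cvgrPdist_lt => e e0; near=> h.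
  rewrite sub0r normrN /= addr0 E0 subr0 [h *: 1]mulr1.
  have -> : h^-1 *: flat m h = flat m.+1 h.
    by rewrite /flat; case: ifP => _; rewrite ?scaler0 // exprS invfM -mulrA.
  rewrite ger0_norm ?flat_ge0 //; apply: le_lt_trans (flat_le _ _) _.
  have f0 : (0 : R) < m.+2`!%:R by rewrite ltr0n fact_gt0.
  rewrite mulrC -ltr_pdivlMr //.
  by near: h; apply: dnbhs0_lt; rewrite divr_gt0.
apply: DeriveDef; first by apply/cvg_ex; exists 0.
by rewrite !E0 mulr0 subr0; exact: (cvg_lim _ L).
Unshelve. all: by end_near. Qed.

Lemma smooth_on_flat (n : nat) (U : set 'rV[R]_n) (r : 'rV[R]_n -> R) :
  open U -> smooth_on U r -> smooth_on U (fun x => flat 0 (r x)).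
Proof.
(* The index 0 is generalized because differentiation raises it by 1 and by 2. *)
move=> oU /smooth_onP sr; apply/smooth_onP => k; move: {2}0%N => m.
have dflat m' t : differentiable (flat m') t.
  by apply/derivable1_diffP; have [] := is_derive_flat m' t.
elim: k m => [|k IH] m.
  move=> [|//] _ x Ux; apply: (@differentiable_comp _ _ _ _ r (flat m)) => //.
  exact: smooth_upto_diff (sr 0%N) Ux.
apply/smooth_uptoSP; split=> [x Ux|i].
  apply: (@differentiable_comp _ _ _ _ r (flat m)) => //.
  exact: smooth_upto_diff (sr 0%N) Ux.
have /smooth_uptoSP [dr sr'] := sr k.+1.
have s1 := smooth_uptoM oU (@smooth_upto_cst _ _ k U (- m%:R)) (IH m.+1).
have := smooth_uptoM oU (smooth_uptoD oU (IH m.+2) s1) (sr' i).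
apply: eq_smooth_upto => // x Ux.
rewrite [RHS](_ : _ = 'd (flat m \o r) x (delta_mx 0 i)); last first.
  by rewrite deriveE //; apply: differentiable_comp => //; exact: (dr x Ux).
rewrite diff_comp //=; last exact: (dr x Ux).
rewrite -(@deriveE _ _ _ r); last exact: (dr x Ux).
rewrite diff1E // derive1E.
have [_ ->] := is_derive_flat m (r x).
by rewrite /GRing.scale /= mulrC mulNr.
Qed.

End Bump.

(** * Bump functions and sections on a manifold *)

Require Import Defs.

Lemma eq_mulmxr (F : pzRingType) (m n : nat) (A B : 'M[F]_(m, n)) :
  (forall v : 'rV[F]_m, v *m A = v *m B) -> A = B.
Proof. by move=> AB; apply/row_matrixP => i; rewrite !rowE. Qed.

(** A change of charts factors through a third chart only on the overlap of the domains, so the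
    chain rule is needed for a composite known only near the point. *)
Lemma diff_comp_near (R : numFieldType) (U V W : normedModType R)
    (f : U -> V) (g : V -> W) (h : U -> W) x y v :
  differentiable f x -> f x = y -> differentiable g y ->
  (\forall z \near x, h z = g (f z)) -> 'd g y ('d f x v) = 'd h x v.
Proof.
move=> df <- dg hE; have dc := differentiable_comp df dg.
have dh : differentiable h x.
  by apply: near_eq_differentiable dc; apply: filterS hE => z ->.
rewrite -[RHS]deriveE // (near_eq_derive _ hE) [RHS](deriveE _ dc).
by rewrite (diff_comp df dg).
Qed.

Section Manifolds.
Context {R : realType} {n : nat} {M : manifold R n}.
Implicit Types (a b c : chart M) (p q : M) (V W : set M) (f g : M -> R).

Lemma param_coord a V x : (coord a @` (dom a `&` V)) x ->
  [/\ dom a (param a x), V (param a x) & coord a (param a x) = x].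
Proof. by move=> [p [ap Vp] <-]; rewrite coordK. Qed.

Lemma param_coord_dom a x : (coord a @` dom a) x ->
  dom a (param a x) /\ coord a (param a x) = x.
Proof. by move=> [p ap <-]; rewrite coordK. Qed.

Lemma open_coord_image a V : open V -> open (coord a @` (dom a `&` V)).
Proof.
move=> oV; rewrite openE => x [p [ap Vp] px].
have ax : (coord a @` dom a) x by exists p.
have Vx : nbhs (param a x) V.
  by apply: open_nbhs_nbhs; split=> //; rewrite -px coordK.
have nd : nbhs x (coord a @` dom a).
  by apply: open_nbhs_nbhs; split=> //; exact: coord_open.
have nV : nbhs x (param a @^-1` V) by exact: (param_continuous ax).
rewrite /interior; apply: filterS (filterI nd nV) => y [[q aq <-]] Vq.
by exists q => //; split=> //; move: Vq; rewrite /preimage /= coordK.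
Qed.

Lemma open_dom2 a b : open (dom a `&` dom b).
Proof. by apply: openI; exact: dom_open. Qed.

Lemma near_coord a V p : open V -> dom a p -> V p ->
  \forall x \near coord a p,
    [/\ dom a (param a x), V (param a x) & coord a (param a x) = x].
Proof.
move=> oV ap Vp; have : nbhs (coord a p) (coord a @` (dom a `&` V)).
  by apply: open_nbhs_nbhs; split; [exact: open_coord_image|exists p].
by apply: filterS => x; exact: param_coord.
Qed.

Definition smooth_in V f : Prop :=
  forall a, smooth_on (coord a @` (dom a `&` V)) (f \o param a).

Lemma smooth_funP f : smooth_fun f <-> smooth_in setT f.
Proof. by split=> sf a; have := sf a; rewrite setIT. Qed.

Lemma smooth_in_sub V W f : W `<=` V -> smooth_in V f -> smooth_in W f.
Proof.
move=> WV sf a; apply: smooth_on_sub (sf a).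
by move=> _ [p [ap Wp] <-]; exists p => //; split=> //; exact: WV.
Qed.

Lemma eq_smooth_in V f g : open V -> (forall p, V p -> f p = g p) ->
  smooth_in V f -> smooth_in V g.
Proof.
move=> oV fg sf a; apply: eq_smooth_on (sf a); first exact: open_coord_image.
by move=> x /param_coord[_ Vx _]; exact: fg.
Qed.

Lemma smooth_in_cst V (k : R) : smooth_in V (fun=> k).
Proof. by move=> a; exact: smooth_on_cst. Qed.

Lemma smooth_inD V f g : open V -> smooth_in V f -> smooth_in V g ->
  smooth_in V (fun p => f p + g p).
Proof.
move=> oV sf sg a.
exact: (smooth_onD (open_coord_image oV) (sf a) (sg a)).
Qed.

Lemma smooth_inM V f g : open V -> smooth_in V f -> smooth_in V g ->
  smooth_in V (fun p => f p * g p).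
Proof.
move=> oV sf sg a.
exact: (smooth_onM (open_coord_image oV) (sf a) (sg a)).
Qed.

Lemma smooth_inV V f : open V -> (forall p, V p -> f p != 0) -> smooth_in V f ->
  smooth_in V (fun p => (f p)^-1).
Proof.
move=> oV f0 sf a; apply: (smooth_onV (open_coord_image oV)) (sf a).
by move=> x /param_coord[_ Vx _]; exact: f0.
Qed.

Lemma smooth_in_sum V (I : Type) (r : seq I) (P : pred I) (F : I -> M -> R) :
  open V -> (forall i, P i -> smooth_in V (F i)) ->
  smooth_in V (fun p => \sum_(i <- r | P i) F i p).
Proof.
move=> oV sF; elim: r => [|i r IH].
  by apply: eq_smooth_in (@smooth_in_cst V 0) => // p _; rewrite big_nil.
have [Pi|Pi] := boolP (P i).
  apply: eq_smooth_in (smooth_inD oV (sF i Pi) IH) => // p _.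
  by rewrite big_cons Pi.
by apply: eq_smooth_in IH => // p _; rewrite big_cons (negPf Pi).
Qed.

(** [smooth_on] is a condition at each point on a function defined everywhere, so local information
    needs no gluing. *)
Lemma smooth_in_local V f :
  (forall p, V p -> exists W, [/\ open W, W p & smooth_in W f]) -> smooth_in V f.
Proof.
move=> H a s x [p [ap Vp] px]; have [W [_ Wp sf]] := H p Vp.
by apply: (sf a s x); exists p.
Qed.

Lemma smooth_in_chart a V f : open V -> V `<=` dom a ->
  smooth_on (coord a @` V) (f \o param a) -> smooth_in V f.
Proof.
move=> oV Va sf b; have oU := open_coord_image oV.
apply: (@eq_smooth_on _ _ _ (fun x => (f \o param a) (coord a (param b x)))) => //.
  by move=> x /param_coord[_ /Va ax _] /=; rewrite coordK.
apply: smooth_on_comp sf => //.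
  by move=> x /param_coord[_ Vx _]; exists (param b x).
move=> j; apply: smooth_on_sub (transition_smooth (a := b) (b := a) j).
by move=> _ [p [bp /Va ap] <-]; exists p.
Qed.

Lemma transition_differentiable a b p : dom a p -> dom b p ->
  differentiable (fun x => coord b (param a x)) (coord a p).
Proof.
move=> ap bp; apply: differentiable_row => j.
by apply: (transition_smooth (a := a) (b := b) j [::]); exists p.
Qed.

Lemma mulmx_transition a b p (v : 'rV[R]_n) :
  v *m transition a b p = 'd (fun x => coord b (param a x)) (coord a p) v.
Proof. by rewrite mul_rV_lin1. Qed.

(** The chain rule. Jacobians act on row vectors from the right, so the factors appear in the order
    in which the charts are traversed. *)
Lemma transition_comp a b c p : dom a p -> dom b p -> dom c p ->
  transition a b p *m transition b c p = transition a c p.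
Proof.
move=> ap bp cp; apply: eq_mulmxr => v.
apply: (etrans (mulmxA _ _ _)).
apply: (etrans (congr1 (mulmx^~ (transition b c p)) (mulmx_transition a b p v))).
apply: (etrans (mulmx_transition b c p _)).
apply: (etrans _ (esym (mulmx_transition a c p v))).
have dab := transition_differentiable ap bp.
have dbc := transition_differentiable bp cp.
apply: (diff_comp_near _ dab _ dbc); first by rewrite coordK.
apply: filterS (near_coord (@dom_open _ _ M b) ap bp) => x [_ bx _].
by rewrite coordK.
Qed.

Lemma transition_id a p : dom a p -> transition a a p = 1%:M.
Proof.
move=> ap; apply: eq_mulmxr => v; rewrite mulmx_transition mulmx1.
rewrite -deriveE; last exact: transition_differentiable.
have near_id : \forall x \near coord a p, coord a (param a x) = id x.
  by apply: filterS (near_coord (@dom_open _ _ M a) ap ap) => x [].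
by rewrite (near_eq_derive _ near_id) derive_id.
Qed.

Lemma transition_entry a b p i j : dom a p -> dom b p ->
  transition a b p i j =
    'D_(delta_mx 0 i) (fun x => coord b (param a x) 0 j) (coord a p).
Proof.
move=> ap bp; have dab := transition_differentiable ap bp.
have -> : transition a b p i j = ((delta_mx 0 i : 'rV_n) *m transition a b p) 0 j.
  by rewrite -rowE [RHS]mxE.
rewrite mulmx_transition -diff_coord // -deriveE //.
exact: (@differentiable_comp _ _ _ _ _ (fun N : 'rV[R]_n => N 0 j : R) _ dab
  (differentiable_coord _ _ _)).
Qed.

Lemma smooth_in_transition a b i j :
  smooth_in (dom a `&` dom b) (fun p => transition a b p i j).
Proof.
have oab := open_dom2 a b.
apply: (smooth_in_chart (a := a)); [exact: oab|by move=> p []|].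
have := smooth_on_derive i (transition_smooth (a := a) (b := b) j).
have oU : open (coord a @` (dom a `&` dom b)).
  by apply: open_coord_image; exact: dom_open.
apply: eq_smooth_on => // x [p [ap bp] <-].
by rewrite /= coordK // transition_entry.
Qed.

Definition smooth_ext V (F : M -> ext R n) : Prop :=
  forall S, smooth_in V (fun p => F p S).

Lemma smooth_ext_sub V W F : W `<=` V -> smooth_ext V F -> smooth_ext W F.
Proof. by move=> WV sF S; exact: smooth_in_sub (sF S). Qed.

Lemma eq_smooth_ext V F G : open V -> (forall p, V p -> F p = G p) ->
  smooth_ext V F -> smooth_ext V G.
Proof.
by move=> oV FG sF S; apply: eq_smooth_in (sF S) => // p Vp; rewrite FG.
Qed.

Lemma smooth_ext_cst V (x : ext R n) : smooth_ext V (fun=> x).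
Proof. by move=> S; exact: smooth_in_cst. Qed.

Lemma smooth_extD V F G : open V -> smooth_ext V F -> smooth_ext V G ->
  smooth_ext V (fun p => F p + G p).
Proof.
move=> oV sF sG S; apply: eq_smooth_in (smooth_inD oV (sF S) (sG S)) => // p _.
by rewrite ffunE.
Qed.

Lemma smooth_extZ V f F : open V -> smooth_in V f -> smooth_ext V F ->
  smooth_ext V (fun p => f p *: F p).
Proof.
move=> oV sf sF S; apply: eq_smooth_in (smooth_inM oV sf (sF S)) => // p _.
by rewrite ffunE.
Qed.

Lemma smooth_ext_sum V (I : Type) (r : seq I) (P : pred I)
    (F : I -> M -> ext R n) :
  open V -> (forall i, P i -> smooth_ext V (F i)) ->
  smooth_ext V (fun p => \sum_(i <- r | P i) F i p).
Proof.
move=> oV sF S.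
have := @smooth_in_sum V I r P (fun i p => F i p S) oV (fun i Pi => sF i Pi S).
by apply: eq_smooth_in => // p _; rewrite sum_ffunE.
Qed.

Lemma smooth_ext_pair V F G : open V -> smooth_ext V F -> smooth_ext V G ->
  smooth_in V (fun p => ext_pair (F p) (G p)).
Proof.
by move=> oV sF sG; apply: smooth_in_sum => // S _; exact: smooth_inM.
Qed.

Lemma smooth_ext_wedge V F G : open V -> smooth_ext V F -> smooth_ext V G ->
  smooth_ext V (fun p => wedge (F p) (G p)).
Proof.
move=> oV sF sG S; pose h p := \sum_(T : {set 'I_n} | T \subset S)
  shuffle_sign R T (S :\: T) * F p T * G p (S :\: T).
have sh : smooth_in V h.
  apply: smooth_in_sum => // T _; apply: smooth_inM => //; apply: smooth_inM => //.
  exact: smooth_in_cst.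
by apply: eq_smooth_in sh => // p _; rewrite ffunE.
Qed.

Lemma smooth_ext_contract V F G : open V -> smooth_ext V F -> smooth_ext V G ->
  smooth_ext V (fun p => contract (F p) (G p)).
Proof.
move=> oV sF sG S.
have := smooth_ext_pair oV sG (smooth_ext_wedge oV sF (@smooth_ext_cst V (ext_e S))).
by apply: eq_smooth_in => // p _; rewrite ffunE.
Qed.

Lemma smooth_ext_push V (J : M -> 'M[R]_n) F : open V ->
  (forall i j, smooth_in V (fun p => J p i j)) -> smooth_ext V F ->
  smooth_ext V (fun p => ext_push (J p) (F p)).
Proof.
move=> oV sJ sF.
apply: smooth_ext_sum => // S _; apply: smooth_extZ => //.
elim: (enum S) => [|i s IH].
  by apply: eq_smooth_ext (@smooth_ext_cst V ext_1) => // p _; rewrite big_nil.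
have si : smooth_ext V (fun p => ext_vec (row i (J p))).
  apply: smooth_ext_sum => // j _; apply: smooth_extZ => //; last exact: smooth_ext_cst.
  by apply: eq_smooth_in (sJ i j) => // p _; rewrite mxE.
by apply: eq_smooth_ext (smooth_ext_wedge oV si IH) => // p _; rewrite big_cons.
Qed.

Lemma smooth_ext_pull V (J : M -> 'M[R]_n) F : open V ->
  (forall i j, smooth_in V (fun p => J p i j)) -> smooth_ext V F ->
  smooth_ext V (fun p => ext_pull (J p) (F p)).
Proof.
move=> oV sJ sF S.
have := smooth_ext_pair oV sF (smooth_ext_push oV sJ (@smooth_ext_cst V (ext_e S))).
by apply: eq_smooth_in => // p _; rewrite ffunE.
Qed.

End Manifolds.

Section Sections.
Context {R : realType} {n : nat} {M : manifold R n}.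
Implicit Types (a b c : chart M) (p q : M) (V W : set M) (f g : M -> R).
Implicit Types (X Y Z w h : section M).

Lemma smooth_fun_in V f : smooth_fun f -> smooth_in V f.
Proof. by move/smooth_funP; exact: smooth_in_sub. Qed.

Lemma smooth_fun_continuous f : smooth_fun f -> continuous f.
Proof.
move=> sf p; pose a := chart_at p; have ap : dom a p := chart_atP p.
have dfa : differentiable (f \o param a : _ -> R) (coord a p).
  by apply: (sf a [::]); exists p.
have cf : {for p, continuous ((f \o param a) \o coord a)}.
  apply: continuous_comp; first exact: coord_continuous.
  exact: differentiable_continuous.
have E : \forall q \near p, ((f \o param a) \o coord a) q = f q.
  have : nbhs p (dom a) by apply: open_nbhs_nbhs; split=> //; exact: dom_open.
  by apply: filterS => q aq /=; rewrite coordK.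
have fE : ((f \o param a) \o coord a) p = f p by rewrite /= coordK.
rewrite /continuous_at -fE; apply: cvg_trans cf; exact: near_eq_cvg.
Qed.

Lemma open_pos f : smooth_fun f -> open [set p | 0 < f p].
Proof.
move=> sf; have := @open_comp _ _ f [set t | 0 < t].
apply; last exact: open_gt.
by move=> p _; exact: smooth_fun_continuous.
Qed.

(** Vanishing off a closed subset of the domain, rather than merely off the domain, is what makes
    [f] times a smooth object on [dom a] smooth on all of [M] after extension by zero: [dom a] and
    the complement of [K] form an open cover. *)
Definition bump a f : Prop := smooth_fun f /\
  exists K : set M, [/\ closed K, K `<=` dom a & forall p, ~ K p -> f p = 0].

Lemma exists_bump a p : dom a p -> exists f, [/\ bump a f, 0 < f p & forall q, 0 <= f q].
Proof.
move=> ap; pose x0 := coord a p.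
have : nbhs x0 (coord a @` dom a).
  by apply: open_nbhs_nbhs; split; [exact: coord_open|exists p].
move=> /nbhs_ballP[e /= e0 eB].
pose d := e / 2; have d0 : 0 < d by rewrite divr_gt0.
(* The norm of ['rV[R]_n] is the maximum norm, which is not smooth in general, hence the sum of
   squares. Its ball of radius [d] lies inside the ball [B] of the maximum norm. *)
pose r (x : 'rV[R]_n) := d ^+ 2 - \sum_j (x 0 j - x0 0 j) ^+ 2.
pose B : set 'rV[R]_n := closed_ball x0 d.
have BE : B = [set x | `|x0 - x| <= d] by rewrite /B closed_ballE.
have Ba : B `<=` coord a @` dom a.
  move=> x; rewrite BE /= => xd; apply: eB; rewrite -ball_normE /=.
  by apply: le_lt_trans xd _; rewrite /d ltr_pdivrMr // ltr_pMr // ltr1n.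
have rB x : 0 < r x -> B x.
  rewrite BE subr_gt0 /= => xd; rewrite [leLHS]/Num.Def.normr /= mx_normrE.
  apply: bigmax_le => [|[i j] _]; first exact: ltW.
  rewrite !mxE ord1 /= distrC -(ler_pXn2r (n := 2)) ?nnegrE ?(ltW d0) //.
  rewrite real_normK ?num_real //; apply: le_trans (ltW xd).
  rewrite (bigD1 j) //= lerDl sumr_ge0 // => k _; exact: sqr_ge0.
have Bc : compact B.
  apply: bounded_closed_compact; last exact: closed_ball_closed.
  have Bd x : B x -> `|x| <= `|x0| + d.
    rewrite BE /= => xd.
    by rewrite -(subrK x0 x) addrC (le_trans (ler_normD _ _)) // lerD2l distrC.
  exists (`|x0| + d); split=> [|N HN x /Bd xN]; first exact: num_real.
  exact: le_trans xN (ltW HN).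
pose K : set M := param a @` B.
(* The Hausdorff axiom enters here: [K] is closed as the continuous image of a compact ball. *)
have Kcl : closed K.
  apply: (compact_closed (@manifold_hausdorff _ _ M)).
  apply: continuous_compact => //; apply: continuous_in_subspaceT => x.
  by rewrite inE => /Ba; exact: param_continuous.
have KE q : dom a q -> 0 < r (coord a q) -> K q.
  by move=> aq /rB rq; exists (coord a q) => //; rewrite coordK.
have sr (U : set 'rV[R]_n) : open U -> smooth_on U r.
  move=> oU; have sdiff j : smooth_on U (fun x => x 0 j - x0 0 j).
    by apply: smooth_onD => //; [exact: smooth_on_coord|exact: smooth_on_cst].
  have s1 : smooth_on U (fun x => -1 * \sum_j (x 0 j - x0 0 j) ^+ 2).
    apply: smooth_onM => //; first exact: smooth_on_cst.
    apply/smooth_onP => k; apply: smooth_upto_sum => // j _.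
    move: k; apply/smooth_onP.
    by have := smooth_onM oU (sdiff j) (sdiff j).
  have := smooth_onD oU (@smooth_on_cst _ _ U (d ^+ 2)) s1.
  by apply: eq_smooth_on => // x _; rewrite mulN1r.
pose chi q := if `[< dom a q >] then flat 0 (r (coord a q)) else 0.
have chiK q : ~ K q -> chi q = 0.
  move=> Kq; rewrite /chi; case: asboolP => // aq.
  by rewrite /flat ifF //; apply/negbTE/negP => /KE; auto.
exists chi; split.
- split; last first.
    by exists K; split=> // _ [x /Ba[q aq <-] <-]; rewrite coordK.
  apply/smooth_funP/smooth_in_local => q _.
  have [aq|aq] := pselect (dom a q).
    exists (dom a); split => //; first exact: dom_open.
    apply: (smooth_in_chart (a := a)) => //; first exact: dom_open.
    have oU := @coord_open _ _ M a.
    have := smooth_on_flat oU (sr _ oU).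
    apply: eq_smooth_on => // x /param_coord_dom[ax xE].
    by rewrite /= /chi asboolT // xE.
  (* A point outside the domain may lie on its boundary; the complement of [K] is a neighbourhood on
     which [chi] is zero. *)
  exists (~` K); split; first exact: closed_openC.
    by move=> [x /Ba[q' aq' <-]]; rewrite coordK // => qE; rewrite qE in aq'.
  have oC : open (~` K) by exact: closed_openC.
  by apply: eq_smooth_in (@smooth_in_cst _ _ _ (~` K) 0) => // q' /chiK.
- rewrite /chi asboolT //; apply: flat0_gt0.
  rewrite /r big1 ?subr0 ?exprn_gt0 // => j _.
  by rewrite subrr expr0n.
- by move=> q; rewrite /chi; case: asboolP => // _; exact: flat_ge0.
Qed.

End Sections.

(** * Components in charts, cut-off coordinate fields, tensoriality *)

Section Components.
Context {R : realType} {n : nat} {M : manifold R n}.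
Implicit Types (a b c : chart M) (p q : M) (V W : set M) (f g : M -> R).
Implicit Types (X Y Z w h : section M) (S T : {set 'I_n}).

(* Indexing the components in the chart [a] by the points of [M], rather than
   by their coordinates, makes them comparable for different charts. *)
Definition mvcomp a X p : ext R n := ext_push (transition (chart_at p) a p) (X p).

Definition formcomp a w p : ext R n :=
  ext_pull (transition a (chart_at p) p) (w p).

Lemma mvcomp_change a b X p : dom a p -> dom b p ->
  mvcomp b X p = ext_push (transition a b p) (mvcomp a X p).
Proof.
move=> ap bp; rewrite /mvcomp [RHS]ext_push_push; congr (ext_push _ _).
apply/esym/transition_comp => //; exact: chart_atP.
Qed.

Lemma formcomp_change a b w p : dom a p -> dom b p ->
  formcomp b w p = ext_pull (transition b a p) (formcomp a w p).
Proof.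
move=> ap bp; rewrite /formcomp [RHS]ext_pull_pull; congr (ext_pull _ _).
apply/esym/transition_comp => //; exact: chart_atP.
Qed.

Lemma mvcomp_chart_at X p : mvcomp (chart_at p) X p = X p.
Proof.
rewrite -[RHS]ext_push_id; congr (ext_push _ _).
by apply: transition_id; exact: chart_atP.
Qed.

Lemma formcomp_chart_at w p : formcomp (chart_at p) w p = w p.
Proof.
rewrite -[RHS]ext_pull_id; congr (ext_pull _ _).
by apply: transition_id; exact: chart_atP.
Qed.

Lemma mvcompK a X p : dom a p ->
  ext_push (transition a (chart_at p) p) (mvcomp a X p) = X p.
Proof.
by move=> ap; rewrite -mvcomp_change ?mvcomp_chart_at //; exact: chart_atP.
Qed.

Lemma pair_comp a w X p : dom a p ->
  ext_pair (formcomp a w p) (mvcomp a X p) = ext_pair (w p) (X p).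
Proof. by move=> ap; rewrite ext_pair_pull mvcompK. Qed.

Lemma mvcomp_wedge a X Y p :
  mvcomp a (swedge X Y) p = wedge (mvcomp a X p) (mvcomp a Y p).
Proof. exact: ext_push_wedge. Qed.

Lemma formcomp_iprod a X w p : dom a p ->
  formcomp a (iprod X w) p = contract (mvcomp a X p) (formcomp a w p).
Proof. by move=> ap; rewrite contract_pull mvcompK. Qed.

Lemma smooth_ext_chart a V (F : M -> ext R n) : open V -> V `<=` dom a ->
  (forall S, smooth_on (coord a @` V) (fun x => F (param a x) S)) ->
  smooth_ext V F.
Proof.
by move=> oV Va sF S; apply: (smooth_in_chart (a := a)) => //; exact: sF.
Qed.

Definition smooth_form w : Prop := forall a (S : {set 'I_n}),
  smooth_on (coord a @` dom a) (fun x => form_in_chart a w x S).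

Lemma multivectorP X : multivector X <-> forall a, smooth_ext (dom a) (mvcomp a X).
Proof.
split=> sX a.
  apply: (smooth_ext_chart (a := a)); [exact: dom_open|by []|exact: sX].
by move=> S; have := sX a S a; rewrite setIid.
Qed.

Lemma smooth_formP w : smooth_form w <-> forall a, smooth_ext (dom a) (formcomp a w).
Proof.
split=> sw a.
  apply: (smooth_ext_chart (a := a)); [exact: dom_open|by []|exact: sw].
by move=> S; have := sw a S a; rewrite setIid.
Qed.

(** One chart near each point suffices, because components in another chart arise by [ext_push]
    along a matrix with smooth entries. *)
Lemma multivector_local X :
  (forall p, exists a V, [/\ open V, V p, V `<=` dom a & smooth_ext V (mvcomp a X)]) ->
  multivector X.
Proof.
move=> H; apply/multivectorP => b S; apply: smooth_in_local => p bp.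
have [a [V [oV Vp Va sX]]] := H p.
exists (V `&` dom b); split=> //; first by apply: openI => //; exact: dom_open.
have oVb : open (V `&` dom b) by apply: openI => //; exact: dom_open.
have sT i j : smooth_in (V `&` dom b) (fun q => transition a b q i j).
  apply: smooth_in_sub (@smooth_in_transition _ _ _ a b i j) => q [Vq bq].
  by split=> //; exact: Va.
have sX' : smooth_ext (V `&` dom b) (mvcomp a X) by apply: smooth_ext_sub sX => q [].
have := smooth_ext_push oVb sT sX' S.
apply: (eq_smooth_in oVb) => q [Vq bq].
exact: (congr1 (fun x : ext R n => x S) (esym (mvcomp_change X (Va _ Vq) bq))).
Qed.

Lemma smooth_form_local w :
  (forall p, exists a V, [/\ open V, V p, V `<=` dom a & smooth_ext V (formcomp a w)]) ->
  smooth_form w.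
Proof.
move=> H; apply/smooth_formP => b S; apply: smooth_in_local => p bp.
have [a [V [oV Vp Va sw]]] := H p.
exists (V `&` dom b); split=> //; first by apply: openI => //; exact: dom_open.
have oVb : open (V `&` dom b) by apply: openI => //; exact: dom_open.
have sT i j : smooth_in (V `&` dom b) (fun q => transition b a q i j).
  apply: smooth_in_sub (@smooth_in_transition _ _ _ b a i j) => q [Vq bq].
  by split=> //; exact: Va.
have sw' : smooth_ext (V `&` dom b) (formcomp a w) by apply: smooth_ext_sub sw => q [].
have := smooth_ext_pull oVb sT sw' S.
apply: (eq_smooth_in oVb) => q [Vq bq].
exact: (congr1 (fun x : ext R n => x S) (esym (formcomp_change w (Va _ Vq) bq))).
Qed.

Lemma smooth_fun_cst (k : R) : smooth_fun (fun _ : M => k).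
Proof. by apply/smooth_funP; exact: smooth_in_cst. Qed.

Lemma smooth_funD f g : smooth_fun f -> smooth_fun g ->
  smooth_fun (fun p => f p + g p).
Proof.
by move=> /smooth_funP sf /smooth_funP sg; apply/smooth_funP/smooth_inD => //; exact: openT.
Qed.

Lemma smooth_funM f g : smooth_fun f -> smooth_fun g ->
  smooth_fun (fun p => f p * g p).
Proof.
by move=> /smooth_funP sf /smooth_funP sg; apply/smooth_funP/smooth_inM => //; exact: openT.
Qed.

Lemma smooth_fun_local f :
  (forall p, exists V, [/\ open V, V p & smooth_in V f]) -> smooth_fun f.
Proof. by move=> H; apply/smooth_funP/smooth_in_local => p _; exact: H. Qed.

Lemma form_eval_smooth w X : smooth_form w -> multivector X ->
  smooth_fun (form_eval w X).
Proof.
move=> /smooth_formP sw /multivectorP sX; apply: smooth_fun_local => p.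
exists (dom (chart_at p)); have od := @dom_open _ _ M (chart_at p).
split=> //; first exact: chart_atP.
have := smooth_ext_pair od (sw (chart_at p)) (sX (chart_at p)).
by apply: (eq_smooth_in od) => q aq; exact: pair_comp.
Qed.

Lemma multivectorD X Y : multivector X -> multivector Y -> multivector (X + Y).
Proof.
move=> /multivectorP sX /multivectorP sY; apply/multivectorP => a.
have od := @dom_open _ _ M a; have := smooth_extD od (sX a) (sY a).
by apply: (eq_smooth_ext od) => p _; rewrite -[LHS]ext_pushD.
Qed.

Lemma multivector_fscale f X : smooth_fun f -> multivector X ->
  multivector (fscale f X).
Proof.
move=> sf /multivectorP sX; apply/multivectorP => a.
have od := @dom_open _ _ M a.
have := smooth_extZ od (smooth_fun_in (V := dom a) sf) (sX a).
by apply: (eq_smooth_ext od) => p _; rewrite -[LHS]ext_pushZ.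
Qed.

Lemma multivector_swedge X Y : multivector X -> multivector Y ->
  multivector (swedge X Y).
Proof.
move=> /multivectorP sX /multivectorP sY; apply/multivectorP => a.
have od := @dom_open _ _ M a; have := smooth_ext_wedge od (sX a) (sY a).
by apply: (eq_smooth_ext od) => p _; rewrite -[LHS]mvcomp_wedge.
Qed.

Lemma multivector_fsec f : smooth_fun f -> multivector (fsec f).
Proof.
move=> sf; apply/multivectorP => a; have od := @dom_open _ _ M a.
have := smooth_extZ od (smooth_fun_in (V := dom a) sf) (@smooth_ext_cst _ _ _ (dom a) ext_1).
by apply: (eq_smooth_ext od) => p _; rewrite [RHS]ext_pushZ ext_push_1.
Qed.

Lemma multivector0 : multivector (0 : section M).
Proof.
apply/multivectorP => a; have od := @dom_open _ _ M a.
apply: (eq_smooth_ext od) (@smooth_ext_cst _ _ _ (dom a) 0) => p _.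
by rewrite [RHS]ext_push0.
Qed.

Lemma smooth_formD w h : smooth_form w -> smooth_form h -> smooth_form (w + h).
Proof.
move=> /smooth_formP sw /smooth_formP sh; apply/smooth_formP => a.
have od := @dom_open _ _ M a; have := smooth_extD od (sw a) (sh a).
by apply: (eq_smooth_ext od) => p _; rewrite -[LHS]ext_pullD.
Qed.

Lemma smooth_form_fscale f w : smooth_fun f -> smooth_form w ->
  smooth_form (fscale f w).
Proof.
move=> sf /smooth_formP sw; apply/smooth_formP => a.
have od := @dom_open _ _ M a.
have := smooth_extZ od (smooth_fun_in (V := dom a) sf) (sw a).
by apply: (eq_smooth_ext od) => p _; rewrite -[LHS]ext_pullZ.
Qed.

Lemma smooth_form_iprod X w : multivector X -> smooth_form w ->
  smooth_form (iprod X w).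
Proof.
move=> /multivectorP sX /smooth_formP sw; apply/smooth_formP => a.
have od := @dom_open _ _ M a; have := smooth_ext_contract od (sX a) (sw a).
by apply: (eq_smooth_ext od) => p ap; rewrite [RHS]formcomp_iprod.
Qed.

Lemma kvectorD (k : int) X Y : kvector k X -> kvector k Y -> kvector k (X + Y).
Proof.
move=> [sX hX] [sY hY]; split; first exact: multivectorD.
by move=> p; exact: homogD.
Qed.

Lemma kvector0 (k : int) : kvector k (0 : section M).
Proof. by split; [exact: multivector0|move=> p; exact: homog0]. Qed.

Lemma kvector_fscale (k : int) f X : smooth_fun f -> kvector k X ->
  kvector k (fscale f X).
Proof.
move=> sf [sX hX]; split; first exact: multivector_fscale.
by move=> p; exact: homogZ.
Qed.

Lemma kvector_swedge (k l : int) X Y : kvector k X -> kvector l Y ->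
  kvector (k + l) (swedge X Y).
Proof.
move=> [sX hX] [sY hY]; split; first exact: multivector_swedge.
by move=> p; exact: homog_wedge.
Qed.

Lemma kvector_fsec f : smooth_fun f -> kvector 0 (fsec f).
Proof.
move=> sf; split; first exact: multivector_fsec.
by move=> p; apply: homogZ; exact: homog_1.
Qed.

Lemma kvector_sum (k : int) (I : Type) (r : seq I) (P : pred I)
    (F : I -> section M) :
  (forall i, P i -> kvector k (F i)) -> kvector k (\sum_(i <- r | P i) F i).
Proof.
by move=> sF; elim/big_ind: _ => //; [exact: kvector0|exact: kvectorD].
Qed.

Lemma kvector0_fun X : kvector 0 X -> smooth_fun (fun p => X p finset.set0).
Proof.
move=> [/multivectorP sX hX]; apply: smooth_fun_local => p.
exists (dom (chart_at p)); have od := @dom_open _ _ M (chart_at p).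
split=> //; first exact: chart_atP.
have := sX (chart_at p) finset.set0; apply: (eq_smooth_in od) => q _.
rewrite /mvcomp (homog0E (hX q)) [ext_push _ _]ext_pushZ ext_push_1.
by rewrite /GRing.scale /= !ffunE.
Qed.

(** A coordinate field of the chart [a], made global by the factor [f]. The matrix rewrites it in
    the trivialization by [chart_at p] in which sections take their values. *)
Definition frame a f S : section M := fun p =>
  if `[< dom a p >] then
    f p *: ext_push (transition a (chart_at p) p) (ext_e S) else 0.

Lemma mvcomp_frame a f S p : dom a p -> mvcomp a (frame a f S) p = f p *: ext_e S.
Proof.
move=> ap; rewrite /mvcomp /frame asboolT // [LHS]ext_pushZ; congr (_ *: _).
rewrite [LHS]ext_push_push -[RHS]ext_push_id; congr (ext_push _ _).
rewrite -(transition_id ap); apply: transition_comp => //; exact: chart_atP.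
Qed.

Lemma frame_chart_at f S p : frame (chart_at p) f S p = f p *: ext_e S.
Proof. by rewrite -(mvcomp_frame f S (chart_atP p)) mvcomp_chart_at. Qed.

Lemma frame_kvector a f S : bump a f -> kvector #|S|%:Z (frame a f S).
Proof.
move=> [sf [K [Kcl Ka fK]]]; split; last first.
  move=> p; rewrite /frame; case: asboolP => _; last exact: homog0.
  by apply/homogZ/homog_push; exact: homog_e.
apply: multivector_local => p; have [ap|ap] := pselect (dom a p).
  have od := @dom_open _ _ M a.
  exists a, (dom a); split=> //.
  have := smooth_extZ od (smooth_fun_in (V := dom a) sf)
    (@smooth_ext_cst _ _ _ (dom a) (ext_e S)).
  by apply: (eq_smooth_ext od) => q aq; rewrite [RHS]mvcomp_frame.
have oK : open (~` K `&` dom (chart_at p)).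
  by apply: openI; [exact: closed_openC|exact: dom_open].
exists (chart_at p), (~` K `&` dom (chart_at p)); split.
- exact: oK.
- by split; [move/Ka|exact: chart_atP].
- by move=> q [].
apply: (eq_smooth_ext oK) (@smooth_ext_cst _ _ _ (~` K `&` dom (chart_at p)) 0).
move=> q [Kq _]; rewrite /mvcomp /frame fK // scale0r.
by case: ifP => _; rewrite [RHS]ext_push0.
Qed.

Lemma frame_wedge a f S T p :
  swedge (frame a f S) (frame a f T) p =
  if `[< dom a p >] then (f p * f p) *: ext_push (transition a (chart_at p) p)
    (wedge (ext_e S) (ext_e T)) else 0.
Proof.
rewrite /swedge /frame; case: asboolP => _; last by rewrite wedge0l.
by rewrite wedgeZl wedgeZr scalerA ext_push_wedge.
Qed.

(** Each factor on the right carries its own [f], hence the extra [f] on the left. Inductions on [S]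
    cancel it where [f] does not vanish. *)
Lemma frame_setU1_min a f (m : 'I_n) S : (forall j, j \in S -> (m < j)%N) ->
  fscale f (frame a f (finset.setU (finset.set1 m) S)) =
  swedge (frame a f (finset.set1 m)) (frame a f S).
Proof.
move=> mS; apply/funext => p; rewrite frame_wedge /fscale /frame.
case: asboolP => _; last by rewrite scaler0.
by rewrite -ext_e_setU1_min // scalerA.
Qed.

Lemma frame0 a f : bump a f -> frame a f finset.set0 = fsec f.
Proof.
move=> [_ [K [_ Ka fK]]]; apply/funext => p; rewrite /frame /fsec.
case: asboolP => ap; first by rewrite ext_push_1.
by rewrite fK ?scale0r // => /Ka.
Qed.

Definition bump_coef a f X S p : R :=
  if `[< dom a p >] then f p * mvcomp a X p S else 0.

Lemma bump_coef_smooth a f X S : bump a f -> multivector X ->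
  smooth_fun (bump_coef a f X S).
Proof.
move=> [sf [K [Kcl Ka fK]]] /multivectorP sX; apply: smooth_fun_local => p.
have [ap|ap] := pselect (dom a p).
  have od := @dom_open _ _ M a; exists (dom a); split=> //.
  have := smooth_inM od (smooth_fun_in (V := dom a) sf) (sX a S).
  by apply: (eq_smooth_in od) => q aq; rewrite /bump_coef asboolT.
have oK : open (~` K) by exact: closed_openC.
exists (~` K); split=> //; first by move/Ka.
apply: eq_smooth_in (@smooth_in_cst _ _ _ (~` K) 0) => // q Kq.
by rewrite /bump_coef fK // mul0r; case: ifP.
Qed.

Lemma bump_sq_frame a f X : bump a f ->
  fscale (fun p => f p * f p) X =
  \sum_(S : {set 'I_n}) fscale (bump_coef a f X S) (frame a f S).
Proof.
move=> [_ [K [_ Ka fK]]]; apply/funext => p; rewrite fct_sumE /fscale.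
have [ap|ap] := pselect (dom a p); last first.
  rewrite fK ?mul0r ?scale0r; last by move/Ka.
  by rewrite big1 // => S _; rewrite /bump_coef asboolF // scale0r.
rewrite -{1}(mvcompK X ap) {1}(ext_sum (mvcomp a X p)) ext_push_sum scaler_sumr.
apply: eq_bigr => S _; rewrite /bump_coef /frame asboolT // ext_pushZ !scalerA.
by congr (_ *: _); ring.
Qed.

Lemma bump_coef_homog a f (k : int) X S p : kvector k X -> #|S|%:Z != k ->
  bump_coef a f X S p = 0.
Proof.
move=> [_ hX] Sk; rewrite /bump_coef; case: asboolP => // ap.
by rewrite (homog_push _ (hX p)) // mulr0.
Qed.

(* Applies [Phi] to the expansion of [f^2 X] in the fields [f e_S], where the
   bump function [f] makes both the coefficients and these fields global. *)
Lemma tensorial_repr (k : int) p (Phi : section M -> R) :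
  (forall X Y, kvector k X -> kvector k Y -> Phi (X + Y) = Phi X + Phi Y) ->
  (forall f X, smooth_fun f -> kvector k X -> Phi (fscale f X) = f p * Phi X) ->
  exists2 x : ext R n, homog k x &
    forall X, kvector k X -> Phi X = ext_pair x (X p).
Proof.
move=> PhiD PhiZ; set a := chart_at p.
have ap : dom a p by exact: chart_atP.
have [f [bf /lt0r_neq0 f0 _]] := exists_bump ap.
have Phi0 : Phi 0 = 0.
  have := PhiD _ _ (kvector0 k) (kvector0 k).
  by rewrite addr0 => /eqP; rewrite -subr_eq0 opprD addNKr oppr_eq0 => /eqP.
(* The field [frame a f S] takes the value [f p *: ext_e S] at [p], hence the division by [f p]. *)
pose x : ext R n := [ffun S : {set 'I_n} =>
  if #|S|%:Z == k then Phi (frame a f S) / f p else 0].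
exists x => [S /negPf Sk|X kX]; first by rewrite ffunE Sk.
have sX : multivector X by case: kX.
have kS S : kvector k (fscale (bump_coef a f X S) (frame a f S)).
  have [<-|Sk] := eqVneq #|S|%:Z k.
    apply: kvector_fscale; last exact: frame_kvector.
    exact: bump_coef_smooth.
  rewrite (_ : fscale _ _ = 0); first exact: kvector0.
  by apply/funext => q; rewrite /fscale (bump_coef_homog _ _ _ kX) // scale0r.
have PhiS (r : seq {set 'I_n}) (F : {set 'I_n} -> section M) :
    (forall S, kvector k (F S)) ->
    Phi (\sum_(S <- r) F S) = \sum_(S <- r) Phi (F S).
  move=> kF; elim: r => [|S r IH]; first by rewrite !big_nil.
  by rewrite !big_cons PhiD ?IH //; exact: kvector_sum.
have sff : smooth_fun (fun q => f q * f q) by apply: smooth_funM; case: bf.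
have := congr1 Phi (bump_sq_frame X bf).
rewrite PhiZ // PhiS // => E.
apply: (mulfI f0); apply: (mulfI f0); rewrite mulrA E /ext_pair !mulr_sumr.
apply: eq_bigr => S _; rewrite ffunE.
have [Sk|Sk] := eqVneq #|S|%:Z k; last first.
  rewrite (_ : fscale _ _ = 0) ?Phi0 ?mul0r ?mulr0 //.
  by apply/funext => q; rewrite /fscale (bump_coef_homog _ _ _ kX) // scale0r.
rewrite PhiZ //; first last.
- by rewrite -Sk; exact: frame_kvector.
- exact: bump_coef_smooth.
rewrite /bump_coef asboolT // mvcomp_chart_at.
by field.
Qed.

End Components.

(** * Exterior derivative and bracket *)

Section Calculus.
Context {R : realType} {n : nat} {M : manifold R n}.
Implicit Types (a b c : chart M) (p q : M) (V : set M) (f g : M -> R).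
Implicit Types (X Y Q w h : section M) (S T : {set 'I_n}).

(** The chart moves with the point, so [pd i f] need not be continuous in [p], even for smooth [f].
    It serves only in identities at one point. *)
Definition pd (i : 'I_n) f p : R :=
  'D_(delta_mx 0 i) (f \o param (chart_at p)) (coord (chart_at p) p).

Lemma pd_cst i (k : R) p : pd i (fun=> k) p = 0.
Proof. by rewrite /pd (_ : _ \o _ = cst k) // derive_cst. Qed.

Lemma eq_pd i V f g p : open V -> V p -> (forall q, V q -> f q = g q) ->
  pd i f p = pd i g p.
Proof.
move=> oV Vp fg; apply: near_eq_derive.
apply: filterS (near_coord oV (chart_atP p) Vp) => x [_ Vx _].
exact: fg.
Qed.

Lemma smooth_in_derivable V f p (v : 'rV[R]_n) : V p -> smooth_in V f ->
  derivable (f \o param (chart_at p)) (coord (chart_at p) p) v.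
Proof.
move=> Vp sf; apply: diff_derivable; apply: (sf (chart_at p) [::]).
by exists p => //; split=> //; exact: chart_atP.
Qed.

Lemma pdD i V f g p : V p -> smooth_in V f -> smooth_in V g ->
  pd i (fun q => f q + g q) p = pd i f p + pd i g p.
Proof.
move=> Vp sf sg.
exact: (deriveD (smooth_in_derivable (v := delta_mx 0 i) Vp sf)
  (smooth_in_derivable Vp sg)).
Qed.

Lemma pdM i V f g p : V p -> smooth_in V f -> smooth_in V g ->
  pd i (fun q => f q * g q) p = f p * pd i g p + g p * pd i f p.
Proof.
move=> Vp sf sg.
have := deriveM (smooth_in_derivable (v := delta_mx 0 i) Vp sf)
  (smooth_in_derivable (v := delta_mx 0 i) Vp sg).
by rewrite /= coordK //; exact: chart_atP.
Qed.

Lemma pdZ i V (k : R) f p : V p -> smooth_in V f ->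
  pd i (fun q => k * f q) p = k * pd i f p.
Proof.
move=> Vp sf; rewrite (pdM i Vp (@smooth_in_cst _ _ _ V k) sf).
by rewrite pd_cst mulr0 addr0.
Qed.

Lemma pd_sum i V (I : Type) (r : seq I) (P : pred I) (F : I -> M -> R) p :
  open V -> V p -> (forall j, smooth_in V (F j)) ->
  pd i (fun q => \sum_(j <- r | P j) F j q) p = \sum_(j <- r | P j) pd i (F j) p.
Proof.
move=> oV Vp sF; elim: r => [|j r IH].
  rewrite big_nil -[RHS](@pd_cst i 0 p); apply: (eq_pd i oV Vp) => q _.
  by rewrite big_nil.
rewrite big_cons; case Pj: (P j).
  have sr : smooth_in V (fun q => \sum_(j <- r | P j) F j q) by exact: smooth_in_sum.
  rewrite -IH -(pdD i Vp (sF j) sr); apply: (eq_pd i oV Vp) => q _.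
  by rewrite big_cons Pj.
rewrite -IH; apply: (eq_pd i oV Vp) => q _.
by rewrite big_cons Pj.
Qed.

Definition dext (i : 'I_n) (F : M -> ext R n) p : ext R n :=
  [ffun S => pd i (fun q => F q S) p].

Lemma eq_dext i V (F G : M -> ext R n) p : open V -> V p ->
  (forall q, V q -> F q = G q) -> dext i F p = dext i G p.
Proof.
move=> oV Vp FG; apply/ffunP => S; rewrite !ffunE.
by apply: (eq_pd i oV Vp) => q Vq; rewrite FG.
Qed.

Lemma dextD i V (F G : M -> ext R n) p : open V -> V p ->
  smooth_ext V F -> smooth_ext V G ->
  dext i (fun q => F q + G q) p = dext i F p + dext i G p.
Proof.
move=> oV Vp sF sG; apply/ffunP => S; rewrite !ffunE -(pdD i Vp (sF S) (sG S)).
by apply: (eq_pd i oV Vp) => q _; rewrite ffunE.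
Qed.

Lemma dextZ i V f (F : M -> ext R n) p : open V -> V p ->
  smooth_in V f -> smooth_ext V F ->
  dext i (fun q => f q *: F q) p = pd i f p *: F p + f p *: dext i F p.
Proof.
move=> oV Vp sf sF; apply/ffunP => S; rewrite !ffunE.
rewrite [RHS](_ : _ = f p * pd i (fun q => F q S) p + F p S * pd i f p).
  rewrite -(pdM i Vp sf (sF S)).
  by apply: (eq_pd i oV Vp) => q _; rewrite ffunE.
by rewrite addrC; congr (_ + _); exact: mulrC.
Qed.

Lemma dext_homog i (k : int) (F : M -> ext R n) p :
  (forall q, homog k (F q)) -> homog k (dext i F p).
Proof.
move=> hF S Sk; rewrite ffunE -[RHS](@pd_cst i 0 p); apply: (eq_pd i openT I).
by move=> q _; rewrite hF.
Qed.

Lemma pd_pair i V (F G : M -> ext R n) p : open V -> V p ->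
  smooth_ext V F -> smooth_ext V G ->
  pd i (fun q => ext_pair (F q) (G q)) p =
    ext_pair (dext i F p) (G p) + ext_pair (F p) (dext i G p).
Proof.
move=> oV Vp sF sG.
have sFG S : smooth_in V (fun q => F q S * G q S) by exact: smooth_inM.
rewrite [LHS](pd_sum i _ _ oV Vp sFG) [ext_pair (dext i F p) _]ext_pairC -big_split.
apply: eq_bigr => S _; rewrite (pdM i Vp (sF S) (sG S)) !ffunE.
exact: addrC.
Qed.

Lemma dext_wedge_cst i V (F : M -> ext R n) (x : ext R n) p : open V -> V p ->
  smooth_ext V F ->
  dext i (fun q => wedge (F q) x) p = wedge (dext i F p) x.
Proof.
move=> oV Vp sF; apply/ffunP => S; rewrite !ffunE.
pose G T q := (shuffle_sign R T (S :\: T) * x (S :\: T)) * F q T.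
have sG T : smooth_in V (G T).
  by apply: smooth_inM => //; exact: smooth_in_cst.
have := pd_sum i (index_enum {set 'I_n}) (fun T => T \subset S) oV Vp sG.
rewrite (_ : pd i _ p = pd i (fun q => wedge (F q) x S) p) => [->|]; last first.
  apply: (eq_pd i oV Vp) => q _; rewrite ffunE; apply: eq_bigr => T _.
  by rewrite /G; ring.
by apply: eq_bigr => T _; rewrite (pdZ i _ Vp (sF T)) ffunE; ring.
Qed.

(** Tested against a constant [x], this is the product rule for the pairing of [G] with
    [wedge (F _) x], read through the adjunction. *)
Lemma dext_contract i V (F G : M -> ext R n) p : open V -> V p ->
  smooth_ext V F -> smooth_ext V G ->
  dext i (fun q => contract (F q) (G q)) p =
    contract (dext i F p) (G p) + contract (F p) (dext i G p).
Proof.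
move=> oV Vp sF sG; apply: ext_pair_inj => x; rewrite ext_pairDl !ext_pair_contract.
have sFx : smooth_ext V (fun q => wedge (F q) x).
  by apply: smooth_ext_wedge => //; exact: smooth_ext_cst.
have := pd_pair i oV Vp sG sFx.
rewrite (dext_wedge_cst i _ oV Vp sF) addrC => <-.
have sFG : smooth_ext V (fun q => contract (F q) (G q)) by exact: smooth_ext_contract.
have := pd_pair i oV Vp sFG (@smooth_ext_cst _ _ _ V x).
rewrite (_ : dext i (fun=> x) p = 0); last first.
  by apply/ffunP => S; rewrite !ffunE pd_cst.
rewrite ext_pair0r addr0 => <-; apply: (eq_pd i oV Vp) => q _.
by rewrite ext_pair_contract.
Qed.

Definition dfun f p : ext R n := \sum_i pd i f p *: ext_b i.

Lemma homog_dfun f p : homog 1 (dfun f p).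
Proof. by apply: homog_sum => i _; apply: homogZ; exact: homog_b. Qed.

Lemma pair_dfun f p (x : ext R n) :
  ext_pair (dfun f p) x = \sum_i pd i f p * x (finset.set1 i).
Proof.
rewrite /dfun ext_pair_suml; apply: eq_bigr => i _.
by rewrite ext_pairZl ext_pair_el.
Qed.

(** Holds by conversion, [form_in_chart a w] being [formcomp a w] composed with [param a]. It
    replaces derivatives in coordinates by [dext], whose rules are stated on [M]. *)
Lemma ext_dE w p : ext_d w p =
  \sum_i wedge (ext_b i) (dext i (formcomp (chart_at p) w) p).
Proof. by []. Qed.

Lemma ext_d0 : ext_d (0 : section M) = 0.
Proof.
apply/funext => p; rewrite ext_dE big1 // => i _.
rewrite (_ : dext _ _ _ = 0) ?wedge0r //; apply/ffunP => S; rewrite !ffunE.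
rewrite -[RHS](@pd_cst i 0 p); apply: (eq_pd i openT I) => q _.
by rewrite (_ : formcomp _ _ _ = 0) ?ffunE //; exact: ext_pull0.
Qed.

Lemma ext_dD w h p : smooth_form w -> smooth_form h ->
  ext_d (w + h) p = ext_d w p + ext_d h p.
Proof.
move=> /smooth_formP sw /smooth_formP sh; rewrite !ext_dE -big_split /=.
apply: eq_bigr => i _; rewrite -wedgeDr; congr (wedge _ _).
have od := @dom_open _ _ M (chart_at p).
rewrite -(dextD i od (chart_atP p) (sw _) (sh _)).
by apply: (eq_dext i od (chart_atP p)) => q _; rewrite -[RHS]ext_pullD.
Qed.

Lemma ext_d_fscale f w p : smooth_fun f -> smooth_form w ->
  ext_d (fscale f w) p = wedge (dfun f p) (w p) + f p *: ext_d w p.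
Proof.
move=> sf /smooth_formP sw; rewrite !ext_dE /dfun wedge_suml scaler_sumr -big_split /=.
have od := @dom_open _ _ M (chart_at p).
apply: eq_bigr => i _.
rewrite wedgeZl -wedgeZr -[f p *: wedge _ _]wedgeZr -wedgeDr; congr (wedge _ _).
rewrite -(formcomp_chart_at w p).
rewrite -(dextZ i od (chart_atP p) (smooth_fun_in sf) (sw _)).
by apply: (eq_dext i od (chart_atP p)) => q _; rewrite -[RHS]ext_pullZ.
Qed.

Lemma homog_ext_d (k : int) w p : (forall q, homog k (w q)) ->
  homog (k + 1) (ext_d w p).
Proof.
move=> hw; rewrite ext_dE; apply: homog_sum => i _; rewrite addrC.
apply: homog_wedge; first exact: homog_b.
by apply: dext_homog => q; exact: homog_pull.
Qed.

Lemma lie_mvE X Q p : lie_mv X Q p =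
  \sum_i (X p (finset.set1 i) *: dext i (mvcomp (chart_at p) Q) p
    - wedge (dext i (mvcomp (chart_at p) X) p) (contract (ext_b i) (Q p))).
Proof. by []. Qed.

Lemma lie_mv_fun X f p : lie_mv X (fsec f) p = ext_pair (dfun f p) (X p) *: ext_1.
Proof.
rewrite lie_mvE pair_dfun scaler_suml; apply: eq_bigr => i _.
rewrite /fsec contractZr contract_bi_ext ?inE // scaler0 wedge0r subr0 mulrC -scalerA.
congr (_ *: _); apply/ffunP => S; rewrite !ffunE.
have [S0|S0] := eqVneq S finset.set0; rewrite ?S0.
  rewrite [RHS]mulr1; apply: (eq_pd i openT I) => q _.
  rewrite [mvcomp _ _ _](ext_pushZ _ _ ext_1) ext_push_1.
  by rewrite !ffunE eqxx; exact: mulr1.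
rewrite [RHS]mulr0 -[RHS](@pd_cst i 0 p); apply: (eq_pd i openT I) => q _.
rewrite [mvcomp _ _ _](ext_pushZ _ _ ext_1) ext_push_1.
by rewrite !ffunE (negPf S0); exact: mulr0.
Qed.

(* The pointwise form of [(L_X w) Q = X (w Q) - w [X, Q]] together with
   [L_X = d i_X + i_X d]. *)
Lemma cartan w X Q p : smooth_form w -> kvector 1 X -> multivector Q ->
  ext_pair (ext_d w p) (wedge (X p) (Q p)) + ext_pair (ext_d (iprod X w) p) (Q p)
  = ext_pair (dfun (form_eval w Q) p) (X p) - ext_pair (w p) (lie_mv X Q p).
Proof.
move=> sw0 [sX0 hX] sQ0.
have /smooth_formP sw := sw0; have /multivectorP sX := sX0.
have /multivectorP sQ := sQ0.
set a := chart_at p; have ap : dom a p := chart_atP p.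
have od := @dom_open _ _ M a.
rewrite !ext_dE lie_mvE pair_dfun !ext_pair_suml ext_pair_sumr -sumrB -big_split.
apply: eq_bigr => i _ /=; rewrite -/a.
have -> : dext i (formcomp a (iprod X w)) p =
    contract (dext i (mvcomp a X) p) (w p) + contract (X p) (dext i (formcomp a w) p).
  rewrite -(formcomp_chart_at w p) -(mvcomp_chart_at X p).
  rewrite -(dext_contract i od ap (sX a) (sw a)).
  by apply: (eq_dext i od ap) => q aq; rewrite [LHS]formcomp_iprod.
have -> : pd i (form_eval w Q) p =
    ext_pair (dext i (formcomp a w) p) (Q p) + ext_pair (w p) (dext i (mvcomp a Q) p).
  rewrite -(formcomp_chart_at w p) -(mvcomp_chart_at Q p).
  rewrite -(pd_pair i od ap (sw a) (sQ a)).
  by apply: (eq_pd i od ap) => q aq; rewrite -[LHS](pair_comp _ _ aq).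
set dw := dext i (formcomp a w) p; set dX := dext i (mvcomp a X) p.
set dQ := dext i (mvcomp a Q) p.
rewrite -!ext_pair_contract.
(* The antiderivation rule yields a term in which [X p] is contracted with [dw]; it cancels the same
   term in the derivative of [iprod X w]. *)
rewrite (contract_wedge_homog1 _ (hX p) (homog_b i)) ext_pair_er.
rewrite wedgeDr !ext_pairDl !ext_pairDr !ext_pairNl !ext_pairNr ext_pairZl ext_pairZr.
(* By symmetry of the pairing, multiplication of forms by [e_i] is adjoint to contraction of
   multivectors by [e_i]. This produces the second term of [lie_mv]. *)
have -> : ext_pair (wedge (ext_b i) (contract dX (w p))) (Q p) =
    ext_pair (w p) (wedge dX (contract (ext_b i) (Q p))).
  rewrite ext_pairC -ext_pair_contract ext_pairC ext_pair_contract.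
  by [].
by ring.
Qed.

End Calculus.

(** * Consequences of the bracket axioms *)

Section Bracket.
Context {R : realType} {n : nat} {M : manifold R n}.
Context {br : section M -> section M -> section M}.
Context (Hbr : schouten_bracket br).
Implicit Types (a : chart M) (p q : M) (f g : M -> R).
Implicit Types (X Y Q w h : section M) (S T : {set 'I_n}).

(** A product with a function is a wedge product with a section of degree 0. In the Leibniz rule the
    first term then contains [[f, g] = 0] and the sign has exponent 0. *)
Lemma br_fun_fscale f g X : smooth_fun f -> smooth_fun g -> multivector X ->
  br (fsec f) (fscale g X) = fscale g (br (fsec f) X).
Proof.
move=> sf sg sX.
have -> : fscale g X = swedge (fsec g) X.
  by apply/funext => p; rewrite /swedge /fsec wedgeZl wedge1x.
rewrite (br_leibniz Hbr (kvector_fsec sf) (kvector_fsec sg) sX) (br_fun Hbr) //.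
apply/funext => p; rewrite mulr0 expr0z scale1r.
rewrite -[LHS]/(wedge 0 (X p) + wedge (fsec g p) (br (fsec f) X p)).
by rewrite wedge0l add0r /fsec wedgeZl wedge1x.
Qed.

(** [[f, -]] and minus the contraction by [df] are both antiderivations, the Leibniz sign being
    [(-1) ^ ((0 - 1) * 1)]. They agree in degree 1, where [[f, F] = - [F, f]] is minus a directional
    derivative. *)
Lemma br_fun_frame f a e S p : smooth_fun f -> bump a e -> dom a p -> e p != 0 ->
  br (fsec f) (frame a e S) p = - contract (dfun f p) (frame a e S p).
Proof.
move=> sf be ap e0; have se : smooth_fun e by case: be.
elim/(@set_min_ind n): S => [|m S mS IH].
  rewrite frame0 // (br_fun Hbr) //.
  (* In degree 0 the contraction has degree -1, hence is zero, like the bracket of two functions. *)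
  have kc := homog_contract (homog_dfun f p) (homogZ (e p) homog_1).
  by rewrite (homog_eq0 _ kc) ?oppr0 // sub0r ltrN10.
set F := frame a e.
have kF T : kvector #|T|%:Z (F T) by exact: frame_kvector.
have sF T : multivector (F T) by case: (kF T).
have kFm : kvector 1 (F (finset.set1 m)) by rewrite -[1]/(1%:Z) -(cards1 m).
have E : e p *: br (fsec f) (F (finset.setU (finset.set1 m) S)) p =
    br (fsec f) (swedge (F (finset.set1 m)) (F S)) p.
  by rewrite -frame_setU1_min // br_fun_fscale.
apply: (scalerI e0); rewrite E (br_leibniz Hbr (kvector_fsec sf) kFm (sF S)).
rewrite -[LHS]/(wedge (br (fsec f) (F (finset.set1 m)) p) (F S p)
  + (-1) ^ ((0 - 1) * 1) *: wedge (F (finset.set1 m) p) (br (fsec f) (F S) p)).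
have -> : e p *: - contract (dfun f p) (F (finset.setU (finset.set1 m) S) p) =
    - contract (dfun f p) (wedge (F (finset.set1 m) p) (F S p)).
  have := congr1 (fun X : section M => X p) (frame_setU1_min a e mS).
  by rewrite /fscale => /= Ep; rewrite scalerN -contractZr Ep.
have [_ hFm] := kFm.
rewrite (contract_wedge_homog1 _ (homog_dfun f p) (hFm p)).
have -> : br (fsec f) (F (finset.set1 m)) p =
    - (ext_pair (dfun f p) (F (finset.set1 m) p) *: ext_1).
  rewrite (br_antisym Hbr (kvector_fsec sf) kFm) subrr mulr0 expr0z scale1r.
  rewrite (br_lie Hbr kFm) ?lie_mv_fun //; last exact: multivector_fsec.
  by rewrite -[LHS]/(- lie_mv (F (finset.set1 m)) (fsec f) p) lie_mv_fun.
rewrite IH [(0 - 1) * 1]mulr1 sub0r exprN1 invrN1 scaleN1r wedgeNr opprK.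
by rewrite wedgeNl wedgeZl wedge1x opprB addrC.
Qed.

(** Each coefficient [S] of [[f, X] + i_df X] at [p] is linear in [X] over the functions, so
    [tensorial_repr] reduces the claim to the fields of [br_fun_frame]. Antisymmetry then supplies
    the sign. *)
Lemma br_funr (k : int) f X p : smooth_fun f -> kvector k X ->
  br X (fsec f) p = (-1) ^ (k - 1) *: contract (dfun f p) (X p).
Proof.
move=> sf kX; have sX : multivector X by case: kX.
suff E : br (fsec f) X p = - contract (dfun f p) (X p).
  rewrite (br_antisym Hbr kX (kvector_fsec sf)).
  rewrite -[LHS]/(- ((-1) ^ ((k - 1) * (0 - 1)) *: br (fsec f) X p)) E scalerN opprK.
  by congr (_ *: _); apply: (@signz_eq_mod2 _ _ _ (1 - k)); ring.
apply/ffunP => S.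
pose Phi Y := (br (fsec f) Y p + contract (dfun f p) (Y p)) S.
suff : Phi X = 0.
  by rewrite /Phi => /eqP; rewrite !ffunE addr_eq0 => /eqP ->.
have sff : multivector (fsec f) by exact: multivector_fsec.
have [|g Y sg [sY _]|x hx xP] := @tensorial_repr _ _ _ k p Phi.
- move=> Y Z [sY _] [sZ _]; rewrite /Phi.
  have := br_linearr Hbr 1 sff sY sZ; rewrite scale1r => ->.
  rewrite -[(1 *: _ + _) p]/(1 *: br (fsec f) Y p + br (fsec f) Z p) scale1r.
  by rewrite -[(Y + Z) p]/(Y p + Z p) contractDr !ffunE addrACA.
- rewrite /Phi br_fun_fscale // /fscale contractZr -scalerDr.
  by rewrite ffunE.
have [e [be e0 _]] := exists_bump (chart_atP p).
rewrite xP // /ext_pair big1 // => T _.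
have [Tk|Tk] := eqVneq #|T|%:Z k; last by rewrite hx // mul0r.
have : Phi (frame (chart_at p) e T) = 0.
  rewrite /Phi br_fun_frame ?lt0r_neq0 //; last exact: chart_atP.
  by rewrite addNr ffunE.
rewrite xP -?Tk; last exact: frame_kvector.
rewrite frame_chart_at ext_pairZr ext_pair_er => /eqP.
by rewrite mulf_eq0 (gt_eqF e0) => /eqP ->; rewrite mul0r.
Qed.

Lemma ext_d_set0 w p : ext_d w p finset.set0 = 0.
Proof.
rewrite -ext_pair_el ext_dE ext_pair_sumr big1 // => i _.
by rewrite -ext_pair_contract contract_bi_ext ?inE // ext_pair0l.
Qed.

(** On the set where [e] is positive, [cartan] expresses [e] times the value of [ext_d w] at
    [F (m |: S)] by smooth functions and the value of [ext_d (iprod (F [set m]) w)] at [F S], which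
    has one index less. *)
Lemma ext_d_eval_smooth w X : smooth_form w -> multivector X ->
  smooth_fun (form_eval (ext_d w) X).
Proof.
move=> sw sX; apply: smooth_fun_local => p; set a := chart_at p.
have ap : dom a p by exact: chart_atP.
have [e [be e0 _]] := exists_bump ap.
have se : smooth_fun e by case: be.
pose V := [set q | 0 < e q] `&` dom a.
have oV : open V by apply: openI; [exact: open_pos|exact: dom_open].
have eV q : V q -> e q != 0 by move=> [/lt0r_neq0].
have seV : smooth_in V (fun q => (e q)^-1).
  exact: (smooth_inV oV eV (smooth_fun_in se)).
exists V; split=> //.
set F := frame a e.
have kF T : kvector #|T|%:Z (F T) by exact: frame_kvector.
have sF T : multivector (F T) by case: (kF T).
have main S : smooth_in V (form_eval (ext_d w) (F S)).
  (* The form varies in the induction, since the next step concerns [iprod (F [set m]) w]. *)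
  elim/(@set_min_ind n): S w sw => [|m S mS IH] w sw.
    apply: (eq_smooth_in oV) (@smooth_in_cst _ _ _ V 0) => q _.
    by rewrite /form_eval /F frame0 // /fsec ext_pairZr ext_pair_er ext_d_set0 mulr0.
  have kFm : kvector 1 (F (finset.set1 m)) by rewrite -[1]/(1%:Z) -(cards1 m).
  have sg : smooth_fun (form_eval w (F S)) by exact: form_eval_smooth.
  (* The directional derivative is read as a bracket with a function, because [br_degree] then gives
     its smoothness. *)
  have s1 : smooth_fun (fun q => br (F (finset.set1 m)) (fsec (form_eval w (F S))) q finset.set0).
    apply: kvector0_fun; have := br_degree Hbr kFm (kvector_fsec sg).
    by rewrite addr0 subrr.
  have s2 : smooth_fun (form_eval w (br (F (finset.set1 m)) (F S))).
    by apply: form_eval_smooth => //; have [] := br_degree Hbr kFm (kF S).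
  have s3 := IH _ (smooth_form_iprod (sF (finset.set1 m)) sw).
  have s4 := smooth_inM oV (@smooth_in_cst _ _ _ V (-1)) (smooth_inD oV (smooth_fun_in s2) s3).
  have := smooth_inM oV seV (smooth_inD oV (smooth_fun_in s1) s4).
  apply: (eq_smooth_in oV) => q Vq.
  apply: (mulfI (eV q Vq)); rewrite mulrA mulfV ?eV // mul1r.
  have -> : e q * form_eval (ext_d w) (F (finset.setU (finset.set1 m) S)) q =
      ext_pair (ext_d w q) (wedge (F (finset.set1 m) q) (F S q)).
    have := congr1 (fun X : section M => X q) (frame_setU1_min a e mS).
    by rewrite /fscale => /= Eq; rewrite /form_eval -ext_pairZr Eq.
  have -> : br (F (finset.set1 m)) (fsec (form_eval w (F S))) q finset.set0 =
      ext_pair (dfun (form_eval w (F S)) q) (F (finset.set1 m) q).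
    rewrite (br_lie Hbr kFm (multivector_fsec sg)) lie_mv_fun !ffunE eqxx.
    exact: mulr1.
  rewrite (br_lie Hbr kFm (sF S)) mulN1r opprD addrA -(cartan q sw kFm (sF S)).
  exact: addrK.
have sc S : smooth_in V (fun q => bump_coef a e X S q * form_eval (ext_d w) (F S) q).
  by apply: smooth_inM => //; apply: smooth_fun_in; exact: bump_coef_smooth.
have s1 := smooth_in_sum (index_enum {set 'I_n}) oV (fun S (_ : true) => sc S).
have := smooth_inM oV seV (smooth_inM oV seV s1).
apply: (eq_smooth_in oV) => q Vq.
apply: (mulfI (eV q Vq)); rewrite [LHS]mulrA mulfV ?eV // mul1r.
apply: (mulfI (eV q Vq)); rewrite [LHS]mulrA mulfV ?eV // mul1r.
have := congr1 (fun X : section M => ext_pair (ext_d w q) (X q)) (bump_sq_frame X be).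
rewrite /= fct_sumE ext_pair_sumr /fscale ext_pairZr mulrA => ->.
by apply: eq_bigr => S _; rewrite ext_pairZr.
Qed.

End Bracket.

(** * Covariant derivatives of forms *)

Section NablaForm.
Context {R : realType} {n : nat} {M : manifold R n}.
Context {br nabla : section M -> section M -> section M}.
Context (Hbr : schouten_bracket br) (Hnabla : higher_connection br nabla).
Implicit Types (a : chart M) (p q : M) (f g : M -> R) (k l j : int).
Implicit Types (X Y W w h : section M) (S T : {set 'I_n}).

(** The coefficient in degree 0 of the defining expression. By [lie_form_top] the Lie derivative
    contributes [(-1) ^ (k - 1)], and [(k - 1) * (l - 1) + (k - 1) = (k - 1) * l]. *)
Definition nabla_rhs k X l w Y p : R :=
  (-1) ^ ((k - 1) * l) * form_eval (ext_d (iprod Y w)) X p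
  - form_eval w (nabla X Y) p.

Lemma homog_iprod k l X w p : kvector k X -> kform l w ->
  homog (l - k) (iprod X w p).
Proof. by move=> [_ hX] [_ hw]; exact: homog_contract. Qed.

Lemma kform_iprod k l X w : kvector k X -> kform l w -> kform (l - k) (iprod X w).
Proof.
move=> kX kw; split; last by move=> p; exact: homog_iprod.
by case: kX => sX _; case: kw => sw _; exact: smooth_form_iprod.
Qed.

(** The form [iprod X w] has degree -1 and vanishes, so one term of the Lie derivative is left. This
    is the case that occurs, since [iprod Y w] has degree [l - (l - k + 1) = k - 1]. *)
Lemma lie_form_top k X w : kvector k X -> (forall p, homog (k - 1) (w p)) ->
  lie_form k X w = fsec (fun p => (-1) ^ (k - 1) * form_eval (ext_d w) X p).
Proof.
move=> [_ hX] hw; apply/funext => p.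
rewrite /lie_form (_ : iprod X w = 0).
  rewrite ext_d0 sub0r; rewrite -[LHS]/(- ((-1) ^ k *: iprod X (ext_d w) p)).
  have hd : homog k (ext_d w p) by rewrite -(subrK 1 k); exact: homog_ext_d.
  rewrite /iprod (contract_same_homog (hX p) hd) /fsec /form_eval scalerA -scaleNr.
  by rewrite signzD exprN1 invrN1 mulrN1 mulNr.
apply/funext => q; apply: (@homog_eq0 _ _ (k - 1 - k)); last exact: homog_contract.
by rewrite addrAC subrr sub0r ltrN10.
Qed.

Lemma is_nabla_formP k X l w h : kvector k X -> kform l w ->
  is_nabla_form nabla k X l w h <-> kform (l - k + 1) h /\
  forall Y, kvector (l - k + 1) Y -> forall p,
    form_eval h Y p = nabla_rhs k X l w Y p.
Proof.
move=> kX kw.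
have E Y : kvector (l - k + 1) Y ->
    ((-1) ^ ((k - 1) * (l - 1)) : R) *: lie_form k X (iprod Y w)
      - fsec (form_eval w (nabla X Y)) = fsec (nabla_rhs k X l w Y).
  move=> kY; rewrite lie_form_top // => [|p]; last first.
    rewrite (_ : k - 1 = l - (l - k + 1)); first exact: homog_iprod.
    by ring.
  apply/funext => p; rewrite /nabla_rhs /fsec scalerBl.
  rewrite -[LHS]/((-1) ^ ((k - 1) * (l - 1)) *:
    (((-1) ^ (k - 1) * form_eval (ext_d (iprod Y w)) X p) *: ext_1)
    - form_eval w (nabla X Y) p *: ext_1).
  rewrite scalerA mulrA -signzD; congr ((_ ^ _ * _) *: _ - _).
  by ring.
split=> -[kh H]; split=> // Y kY; last by rewrite E //; congr fsec; apply/funext; exact: H.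
move=> p; have := H Y kY; rewrite E // => /(congr1 (fun X : section M => X p finset.set0)).
by rewrite /fsec !ffunE eqxx => H'; rewrite -[LHS]mulr1 [LHS]H'; exact: mulr1.
Qed.

(** The left side is the extra term of [d (f i_Y w)], the right side that of [nabla X (fscale f Y)].
    Their equality gives tensoriality in [Y]; for [fscale f w] only the left one occurs, and it
    becomes the term with [br X (fsec f)]. *)
Lemma br_fun_pair k l f X Y w p : smooth_fun f -> kvector k X -> kform l w ->
  kvector (l - k + 1) Y ->
  (-1) ^ ((k - 1) * l) * ext_pair (wedge (dfun f p) (contract (Y p) (w p))) (X p)
  = ext_pair (w p) (wedge (br X (fsec f) p) (Y p)).
Proof.
move=> sf kX [_ hw] [_ hY]; have [_ hX] := kX.
rewrite (br_funr Hbr p sf kX) wedgeZl ext_pairZr.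
rewrite ext_pairC -ext_pair_contract ext_pairC ext_pair_contract.
have hc := homog_contract (homog_dfun f p) (hX p).
rewrite (wedgeC_homog (hY p) hc) ext_pairZr mulrA -signzD; congr (_ * _).
(* Moving the contraction past [Y] leaves the exponent [(k - 1) * (2 * l - k + 1)], which is
   congruent to [(k - 1) * (k - 1)] modulo 2. *)
rewrite -(signz_sq (k - 1)); apply: (@signz_eq_mod2 _ _ _ ((k - 1) * (l - k + 1))).
by ring.
Qed.

Lemma iprodDl X Y w : iprod (X + Y) w = iprod X w + iprod Y w.
Proof. by apply/funext => p; exact: contractDl. Qed.

Lemma iprod_fscalel f X w : iprod (fscale f X) w = fscale f (iprod X w).
Proof. by apply/funext => p; exact: contractZl. Qed.

Lemma iprod_fscaler f X w : iprod X (fscale f w) = fscale f (iprod X w).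
Proof. by apply/funext => p; exact: contractZr. Qed.

Lemma nabla_rhsD k X l w Y Y' p : kvector k X -> kform l w ->
  multivector Y -> multivector Y' ->
  nabla_rhs k X l w (Y + Y') p = nabla_rhs k X l w Y p + nabla_rhs k X l w Y' p.
Proof.
move=> [sX _] [sw _] sY sY'.
have sYw : smooth_form (iprod Y w) by exact: smooth_form_iprod.
have sYw' : smooth_form (iprod Y' w) by exact: smooth_form_iprod.
rewrite /nabla_rhs /form_eval iprodDl ext_dD // (nabla_addr Hnabla) // ext_pairDl.
rewrite -[(nabla X Y + nabla X Y') p]/(nabla X Y p + nabla X Y' p) ext_pairDr.
by ring.
Qed.

Lemma nabla_rhs_fscale k X l w f Y p : smooth_fun f -> kvector k X -> kform l w ->
  kvector (l - k + 1) Y ->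
  nabla_rhs k X l w (fscale f Y) p = f p * nabla_rhs k X l w Y p.
Proof.
move=> sf kX kw kY; have [[[sX _] [sw _]] [sY _]] := (kX, kw, kY).
have sYw : smooth_form (iprod Y w) by exact: smooth_form_iprod.
rewrite /nabla_rhs /form_eval iprod_fscalel ext_d_fscale // (nabla_leibniz Hnabla) //.
rewrite ext_pairDl mulrDr (br_fun_pair p sf kX kw kY) ext_pairZl.
rewrite -[(swedge _ _ + _) p]/(wedge (br X (fsec f) p) (Y p) + f p *: nabla X Y p).
rewrite ext_pairDr ext_pairZr; ring.
Qed.

Lemma nabla_rhs_smooth k X l w Y : kvector k X -> kform l w -> multivector Y ->
  smooth_fun (nabla_rhs k X l w Y).
Proof.
move=> [sX _] [sw _] sY.
have s1 := ext_d_eval_smooth Hbr (smooth_form_iprod sY sw) sX.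
have s2 := form_eval_smooth sw (nabla_multivector Hnabla sX sY).
have := smooth_funD (smooth_funM (smooth_fun_cst ((-1) ^ ((k - 1) * l))) s1)
  (smooth_funM (smooth_fun_cst (-1)) s2).
by congr smooth_fun; apply/funext => p; rewrite mulN1r.
Qed.

Lemma exists_nabla_form k X l w : kvector k X -> kform l w ->
  exists h, is_nabla_form nabla k X l w h.
Proof.
move=> kX kw; set m := l - k + 1.
have /choice[h hP] : forall p, exists x : ext R n, homog m x /\
    forall Y, kvector m Y -> nabla_rhs k X l w Y p = ext_pair x (Y p).
  move=> p; have [||x hx xP] := @tensorial_repr _ _ _ m p
      (fun Y => nabla_rhs k X l w Y p).
  - by move=> Y Y' [sY _] [sY' _]; exact: nabla_rhsD.
  - by move=> f Y sf kY; exact: nabla_rhs_fscale.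
  by exists x.
exists h; apply/is_nabla_formP => //; split; last first.
  by move=> Y kY p; rewrite (hP p).2.
split; last by move=> p; case: (hP p).
apply: smooth_form_local => p; set a := chart_at p.
have ap : dom a p by exact: chart_atP.
have [e [be e0 _]] := exists_bump ap.
have se : smooth_fun e by case: be.
pose V := [set q | 0 < e q] `&` dom a.
have oV : open V by apply: openI; [exact: open_pos|exact: dom_open].
have eV q : V q -> e q != 0 by move=> [/lt0r_neq0].
have seV : smooth_in V (fun q => (e q)^-1).
  exact: (smooth_inV oV eV (smooth_fun_in se)).
exists a, V; split=> //; first by move=> q [].
move=> S; have [Sm|Sm] := eqVneq #|S|%:Z m; last first.
  apply: (eq_smooth_in oV) (@smooth_in_cst _ _ _ V 0) => q _.
  by rewrite (homog_pull _ (hP q).1).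
have kF : kvector m (frame a e S) by rewrite -Sm; exact: frame_kvector.
have sF : multivector (frame a e S) by case: kF.
(* The forms at single points were chosen independently, but on [V] the component at [S] must equal
   [nabla_rhs] at [frame a e S] divided by [e], a smooth function. *)
have := smooth_inM oV seV (smooth_fun_in (nabla_rhs_smooth kX kw sF)).
apply: (eq_smooth_in oV) => q Vq; apply: (mulfI (eV q Vq)).
rewrite mulrA mulfV ?eV // mul1r (hP q).2 //; case: Vq => _ aq.
rewrite -(pair_comp _ _ aq) mvcomp_frame // ext_pairZr.
by congr (_ * _); exact: ext_pair_er.
Qed.

Lemma form_ext k h h' : (forall p, homog k (h p)) -> (forall p, homog k (h' p)) ->
  (forall Y, kvector k Y -> forall p, form_eval h Y p = form_eval h' Y p) ->
  h = h'.
Proof.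
move=> hh hh' H; apply/funext => p; apply/ffunP => S.
have [Sk|Sk] := eqVneq #|S|%:Z k; last by rewrite hh // hh'.
have [e [be /lt0r_neq0 e0 _]] := exists_bump (chart_atP p).
have kF : kvector k (frame (chart_at p) e S) by rewrite -Sk; exact: frame_kvector.
apply: (mulfI e0); have := H _ kF p.
by rewrite /form_eval frame_chart_at !ext_pairZr !ext_pair_er.
Qed.

Lemma nabla_form_spec k X l w : 0 < k -> 0 <= l - k + 1 -> kvector k X ->
  kform l w -> is_nabla_form nabla k X l w (nabla_form nabla k X l w).
Proof.
move=> k0 lk kX kw; rewrite /nabla_form k0 lk.
exact: (@xgetPex _ 0 _ (exists_nabla_form kX kw)).
Qed.

(** [nabla_form] is obtained by choice; this uniqueness reduces each of the three identities to an
    equality of functions. *)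
Lemma nabla_form_eq k X l w h : 0 < k -> 0 <= l - k + 1 -> kvector k X ->
  kform l w -> kform (l - k + 1) h ->
  (forall Y, kvector (l - k + 1) Y -> forall p,
    form_eval h Y p = nabla_rhs k X l w Y p) ->
  nabla_form nabla k X l w = h.
Proof.
move=> k0 lk kX kw kh hE.
have /(is_nabla_formP _ kX kw)[[_ hn] nE] := nabla_form_spec k0 lk kX kw.
have [_ hh] := kh.
by apply: (form_ext hn hh) => Y kY p; rewrite hE // nE.
Qed.

Lemma nabla_form_eval k X l w Y p : 0 < k -> 0 <= l - k + 1 -> kvector k X ->
  kform l w -> kvector (l - k + 1) Y ->
  form_eval (nabla_form nabla k X l w) Y p = nabla_rhs k X l w Y p.
Proof.
move=> k0 lk kX kw kY.
have /(is_nabla_formP _ kX kw)[_] := nabla_form_spec k0 lk kX kw; exact.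
Qed.

Lemma kform_nabla_form k X l w : 0 < k -> 0 <= l - k + 1 -> kvector k X ->
  kform l w -> kform (l - k + 1) (nabla_form nabla k X l w).
Proof. by move=> k0 lk kX kw; have [] := nabla_form_spec k0 lk kX kw. Qed.

Lemma nabla_form_lt0 k X l w : l - k + 1 < 0 -> nabla_form nabla k X l w = 0.
Proof. by move=> lk; rewrite /nabla_form leNgt lk andbF. Qed.

Lemma nabla0 Y : multivector Y -> nabla 0 Y = 0.
Proof.
move=> sY; have s0 := @multivector0 _ _ M.
have := nabla_linearl Hnabla (smooth_fun_cst 1) s0 s0 sY.
rewrite addr0 (_ : fscale _ 0 = 0) => [|]; last by apply/funext => p; exact: scaler0.
move=> H; apply/funext => p; have := congr1 (fun X : section M => X p) H.
rewrite -[X in _ = X -> _]/(1 *: nabla 0 Y p + nabla 0 Y p) scale1r => /eqP.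
by rewrite -subr_eq0 opprD addNKr oppr_eq0 => /eqP.
Qed.

Lemma nabla_fscalel f X Y : smooth_fun f -> multivector X -> multivector Y ->
  nabla (fscale f X) Y = fscale f (nabla X Y).
Proof.
move=> sf sX sY; have s0 := @multivector0 _ _ M.
by have := nabla_linearl Hnabla sf sX s0 sY; rewrite addr0 nabla0 // addr0.
Qed.

Lemma nabla_r0 X : multivector X -> nabla X 0 = 0.
Proof.
move=> sX; have s0 := @multivector0 _ _ M.
have := nabla_addr Hnabla sX s0 s0; rewrite addr0 => /eqP.
by rewrite -subr_eq0 opprD addNKr oppr_eq0 => /eqP.
Qed.

Lemma kform_fscale f l w : smooth_fun f -> kform l w -> kform l (fscale f w).
Proof.
move=> sf [sw hw]; split; first exact: smooth_form_fscale.
by move=> p; exact: homogZ.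
Qed.

Lemma kformD l w h : kform l w -> kform l h -> kform l (w + h).
Proof.
move=> [sw hw] [sh hh]; split; first exact: smooth_formD.
by move=> p; exact: homogD.
Qed.

Lemma kform0 l : kform l (0 : section M).
Proof.
split; last by move=> p; exact: homog0.
apply/smooth_formP => a S; have od := @dom_open _ _ M a.
apply: (eq_smooth_in od) (@smooth_in_cst _ _ _ (dom a) 0) => p _.
by rewrite /formcomp ext_pull0 ffunE.
Qed.

Lemma iprod_lt0 k l X w : l < k -> kvector k X -> kform l w -> iprod X w = 0.
Proof.
move=> lk kX kw; apply/funext => p; apply: (@homog_eq0 _ _ (l - k)).
  by rewrite subr_lt0.
exact: homog_iprod.
Qed.

Lemma nabla_form_fscalel k X l w f : 0 < k -> kvector k X -> kform l w ->
  smooth_fun f ->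
  nabla_form nabla k (fscale f X) l w = fscale f (nabla_form nabla k X l w).
Proof.
move=> k0 kX kw sf; have [lk|lk] := leP 0 (l - k + 1); last first.
  by rewrite !nabla_form_lt0 //; apply/funext => p; rewrite /fscale scaler0.
apply: nabla_form_eq => //; first exact: kvector_fscale.
  by apply: kform_fscale => //; exact: kform_nabla_form.
move=> Y kY p; have [[sX _] [sY _]] := (kX, kY).
rewrite /form_eval ext_pairZl.
have := nabla_form_eval p k0 lk kX kw kY; rewrite /form_eval => ->.
by rewrite /nabla_rhs /form_eval nabla_fscalel // /fscale !ext_pairZr; ring.
Qed.

Lemma nabla_form_fscaler k X l w f : 0 < k -> kvector k X -> kform l w ->
  smooth_fun f ->
  nabla_form nabla k X l (fscale f w) =
    fscale f (nabla_form nabla k X l w) + iprod (br X (fsec f)) w.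
Proof.
move=> k0 kX kw sf.
have kb : kvector (k - 1) (br X (fsec f)).
  by have := br_degree Hbr kX (kvector_fsec sf); rewrite addr0.
have [lk|lk] := leP 0 (l - k + 1); last first.
  rewrite !nabla_form_lt0 // (iprod_lt0 _ kb kw) ?addr0; last by lia.
  by apply/funext => p; rewrite /fscale scaler0.
apply: nabla_form_eq => //; first exact: kform_fscale.
  apply: kformD; first by apply: kform_fscale => //; exact: kform_nabla_form.
  by rewrite (_ : l - k + 1 = l - (k - 1)); [exact: kform_iprod|ring].
move=> Y kY p; have [[[sX _] [sY _]] [sw _]] := (kX, kY, kw).
have := nabla_form_eval p k0 lk kX kw kY; rewrite /form_eval => E.
rewrite -[LHS]/(ext_pair (f p *: nabla_form nabla k X l w p
  + contract (br X (fsec f) p) (w p)) (Y p)).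
rewrite ext_pairDl ext_pairZl E ext_pair_contract -(br_fun_pair p sf kX kw kY).
have sYw : smooth_form (iprod Y w) by exact: smooth_form_iprod.
rewrite /nabla_rhs /form_eval iprod_fscaler ext_d_fscale // ext_pairDl.
by rewrite /fscale !ext_pairZl /iprod; ring.
Qed.

(** Since [i_(W /\ Y) = i_Y i_W], the covariant derivative of [w] at [swedge W Y] and that of
    [iprod W w] at [Y] contain the same exterior derivative. The upper induced rule splits
    [nabla X (swedge W Y)], and the part with [nabla X W] cancels the second term of the claim. *)
Lemma nabla_form_iprod k X l w j W : upper_induced nabla -> 0 < k ->
  kvector k X -> kform l w -> kvector j W ->
  nabla_form nabla k X (l - j) (iprod W w)
    = ((-1) ^ (j * (k - 1)) : R) *:
      (iprod W (nabla_form nabla k X l w) + iprod (nabla X W) w).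
Proof.
move=> Hup k0 kX kw kW; have [sX _] := kX.
have kWw := kform_iprod kW kw.
have kn := nabla_degree Hnabla kX kW.
(* For negative [j] the field [W] is zero. The case is separate because [0 <= l - j - k + 1] gives
   [0 <= l - k + 1] only when [j] is nonnegative. *)
have [j0|j0] := leP 0 j; last first.
  have W0 : W = 0 by apply/funext => p; apply: (homog_eq0 j0); case: kW.
  have i0 (h : section M) : iprod 0 h = 0 by apply/funext => p; exact: contract0l.
  rewrite W0 nabla_r0 // !i0 addr0 scaler0.
  have [lk|lk] := leP 0 (l - j - k + 1); last exact: nabla_form_lt0.
  apply: nabla_form_eq => //; [exact: kform0|exact: kform0|].
  move=> Y kY p; rewrite /nabla_rhs (_ : iprod Y 0 = 0); last first.
    by apply/funext => q; exact: contract0r.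
  by rewrite ext_d0 /form_eval !ext_pair0l mulr0 subr0.
(* If the target degree is negative, the left side is 0 by convention and both interior products on
   the right vanish for reasons of degree. *)
have [lk|lk] := leP 0 (l - j - k + 1); last first.
  rewrite nabla_form_lt0 // (iprod_lt0 _ kn kw) ?addr0; last by lia.
  rewrite (_ : iprod W _ = 0) ?scaler0 //.
  have [lk'|lk'] := leP 0 (l - k + 1); last first.
    by rewrite nabla_form_lt0 //; apply/funext => p; exact: contract0r.
  by apply: (iprod_lt0 _ kW (kform_nabla_form k0 lk' kX kw)); lia.
have lk' : 0 <= l - k + 1 by lia.
have kh := kform_nabla_form k0 lk' kX kw.
apply: nabla_form_eq => //.
  rewrite (_ : _ *: _ = fscale (fun=> (-1) ^ (j * (k - 1)))
    (iprod W (nabla_form nabla k X l w) + iprod (nabla X W) w)) //.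
  apply: kform_fscale; first exact: smooth_fun_cst.
  apply: kformD.
    by rewrite (_ : l - j - k + 1 = l - k + 1 - j); [exact: kform_iprod|ring].
  by rewrite (_ : l - j - k + 1 = l - (k + j - 1)); [exact: kform_iprod|ring].
move=> Y kY p; have [sY _] := kY.
have kWY : kvector (l - k + 1) (swedge W Y).
  by rewrite (_ : l - k + 1 = j + (l - j - k + 1)); [exact: kvector_swedge|ring].
rewrite -[LHS]/(ext_pair ((-1) ^ (j * (k - 1)) *:
  (contract (W p) (nabla_form nabla k X l w p) + contract (nabla X W p) (w p))) (Y p)).
rewrite ext_pairZl ext_pairDl !ext_pair_contract.
have := nabla_form_eval p k0 lk' kX kw kWY; rewrite /form_eval /swedge => ->.
rewrite /nabla_rhs /form_eval.
rewrite (_ : iprod (fun q => wedge (W q) (Y q)) w = iprod Y (iprod W w)); last first.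
  by apply/funext => q; rewrite /iprod contract_contract.
rewrite -/(swedge W Y) (Hup k j) //.
rewrite -[(swedge _ _ + _) p]/(wedge (nabla X W p) (Y p) +
  (-1) ^ ((k - 1) * j) *: wedge (W p) (nabla X Y p)).
rewrite ext_pairDr ext_pairZr [ext_pair (iprod W w p) _]ext_pair_contract.
rewrite (mulrC j); set s := (-1) ^ ((k - 1) * j).
have ss : s * s = 1 by rewrite /s -signzD; apply: (@signz_eq_mod2 _ _ 0 ((k - 1) * j)); ring.
have -> : (-1) ^ ((k - 1) * (l - j)) = (-1) ^ ((k - 1) * l) * s.
  by rewrite /s -signzD; apply: (@signz_eq_mod2 _ _ _ (- ((k - 1) * j))); ring.
(* The term with [nabla X Y] has the coefficient [s * s] on the left, one sign from the claim and
   one from the upper induced rule; the coefficient 1 on the right is rewritten to match. *)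
rewrite -[X in _ = _ - X]mul1r -ss; ring.
Qed.

End NablaForm.

Theorem theorem4p7 (R : realType) (n : nat) (M : manifold R n)
    (br nabla : section M -> section M -> section M)
    (Hbr : schouten_bracket br) (Hnabla : higher_connection br nabla) :
  (forall (k l : int) (X w : section M) (f : M -> R),
     0 < k -> kvector k X -> kform l w -> smooth_fun f ->
     nabla_form nabla k (fscale f X) l w
       = fscale f (nabla_form nabla k X l w)
     /\
     nabla_form nabla k X l (fscale f w)
       = fscale f (nabla_form nabla k X l w)
         + iprod (br X (fsec f)) w)
  /\
  (upper_induced nabla ->
   forall (k l j : int) (X w W : section M),
     0 < k -> kvector k X -> kform l w -> kvector j W ->
     nabla_form nabla k X (l - j) (iprod W w)
       = ((-1) ^ (j * (k - 1)) : R) *: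
         (iprod W (nabla_form nabla k X l w) + iprod (nabla X W) w)).
Proof.
split=> [k l X w f k0 kX kw sf|Hup k l j X w W k0 kX kw kW].
  split; first exact: (nabla_form_fscalel Hbr Hnabla).
  exact: (nabla_form_fscaler Hbr Hnabla).
exact: (nabla_form_iprod Hbr Hnabla).
Qed.
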